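(* Let $n$ be the number of coflows (jobs) of an instance. There exists a $\left(\frac{2n}{n+1}\lambda+1\right)$-approximation algorithm for Path-based Coflow Scheduling with arbitrary release times, and a $\left(\frac{2n}{n+1}\lambda\right)$-approximation algorithm for Path-based Coflow Scheduling when all release times satisfy $r_k<\lambda$.
   Context: Path-based Coflow Scheduling (PCS): An instance consists of a multigraph $G_I=(V_I,E_I)$ whose $m$ nodes are machines, and $n$ coflows (jobs) $k\in[n]$. Coflow $k$ has a weight $w_k\ge 0$, a release time $r_k\in\mathbb{Z}_{\ge 0}$, and flows $f_j^{(k)}$, $j\in[n_k]$; flow $f_j^{(k)}$ must send $c_j^{(k)}\in\mathbb{N}$ unit-sized packets along a given fixed path $P_j^{(k)}$ of $G_I$ (a unit occupies every node of $P_j^{(k)}$ in the time step in which it is sent). Let $\lambda=\max_{k,j}|P_j^{(k)}|$ be the maximum number of nodes of a flow path. Time is discrete, $t=1,2,\dots$. A schedule assigns each flow $f_j^{(k)}$ to $c_j^{(k)}$ distinct time steps, all at least $r_k+1$, such that in every time step every node lies on the path of at most one unit scheduled in that step. The completion time $C_k$ is the last time step in which a unit of a flow of coflow $k$ is scheduled; the objective is to minimize $\sum_k w_kC_k$. An $\alpha$-approximation algorithm is a polynomial-time algorithm always outputting a feasible schedule with objective value at most $\alpha$ times the optimum. *)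

(* Defs.v *)
From mathcomp Require Import all_boot all_order all_algebra.

Set Implicit Arguments.
Unset Strict Implicit.
Unset Printing Implicit Defensive.

Import Order.TTheory GRing.Theory Num.Theory.

(* Nodes are the numbers below [nnodes], edges the positions in [edges]; an
   entry of [edges] is the pair of ends of an undirected edge, so parallel edges
   and loops are possible.  The path of a flow starts at [source], and each
   entry [(e, v)] of [steps] traverses the edge [e] to reach the node [v].
   Weights are rational because an algorithm receives them as input. *)
Record flow := Flow {
  demand : nat;
  source : nat;
  steps : seq (nat * nat) }.

Record coflow := Coflow {
  weight : rat;
  release : nat;
  flows : seq flow }.

Record instance := Instance {
  nnodes : nat;
  edges : seq (nat * nat);
  coflows : seq coflow }.

Definition nodes (f : flow) : seq nat := source f :: [seq s.2 | s <- steps f].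

Fixpoint walk (E : seq (nat * nat)) (u : nat) (s : seq (nat * nat)) : bool :=
  if s is (e, v) :: s' then
    [&& e < size E, nth (0, 0) E e \in [:: (u, v); (v, u)] & walk E v s']
  else true.

Definition is_path (I : instance) (f : flow) : bool :=
  [&& all (fun v => v < nnodes I) (nodes f), uniq (nodes f)
    & walk (edges I) (source f) (steps f)].

Definition valid_instance (I : instance) : bool :=
  all (fun e => (e.1 < nnodes I) && (e.2 < nnodes I)) (edges I) &&
  all (fun K => (0 <= weight K)%R && all (is_path I) (flows K)) (coflows I).

Definition ncoflows (I : instance) : nat := size (coflows I).

Definition max_path (I : instance) : nat :=
  \max_(K <- coflows I) \max_(f <- flows K) size (nodes f).

Definition coflow_at (I : instance) (k : nat) : coflow :=
  nth (Coflow 0%R 0 [::]) (coflows I) k.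

Definition nflows (I : instance) (k : nat) : nat := size (flows (coflow_at I k)).

Definition flow_at (I : instance) (k j : nat) : flow :=
  nth (Flow 0 0 [::]) (flows (coflow_at I k)) j.

Definition is_flow (I : instance) (k j : nat) : bool :=
  (k < ncoflows I) && (j < nflows I k).

(* [S k j] lists the time steps assigned to flow [j] of coflow [k]; coflows and
   flows are numbered from 0, time steps from 1. *)
Definition schedule := nat -> nat -> seq nat.

Definition feasible (I : instance) (S : schedule) : Prop :=
  (forall k j, is_flow I k j ->
     [/\ uniq (S k j), size (S k j) = demand (flow_at I k j)
       & forall t, t \in S k j -> release (coflow_at I k) + 1 <= t]) /\
  (forall t v k j k' j',
     is_flow I k j -> t \in S k j -> v \in nodes (flow_at I k j) ->
     is_flow I k' j' -> t \in S k' j' -> v \in nodes (flow_at I k' j') ->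
     (k, j) = (k', j')).

Definition completion (I : instance) (S : schedule) (k : nat) : nat :=
  \max_(j < nflows I k) \max_(t <- S k j) t.

Definition objective (I : instance) (S : schedule) : rat :=
  (\sum_(k < ncoflows I) weight (coflow_at I k) * (completion I S k)%:R)%R.

Definition optimal (I : instance) (S : schedule) : Prop :=
  feasible I S /\
  forall S', feasible I S' -> (objective I S <= objective I S')%R.

(* Structured programs over a memory of unbounded natural numbers, with a
   one-way input tape and a one-way output tape.  Every access to a number and
   every arithmetic operation is charged the bit lengths of the numbers
   involved, addresses included, so that time is polynomially related to
   Turing machine time in spite of the multiplication. *)
Definition bitlen (n : nat) : nat := (trunc_log 2 n).+1.

Inductive binop := Plus | Minus | Times | Quotient.

Definition binop_fun (o : binop) : nat -> nat -> nat :=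
  match o with
  | Plus => addn
  | Minus => subn
  | Times => muln
  | Quotient => divn
  end.

Inductive expr :=
  | Const of nat
  | Cell of expr
  | Bin of binop & expr & expr.

Definition memory := nat -> nat.

Fixpoint eval (M : memory) (e : expr) : nat :=
  match e with
  | Const n => n
  | Cell a => M (eval M a)
  | Bin o e1 e2 => binop_fun o (eval M e1) (eval M e2)
  end.

Fixpoint eval_cost (M : memory) (e : expr) : nat :=
  match e with
  | Const n => bitlen n
  | Cell a => eval_cost M a + bitlen (eval M a) + bitlen (M (eval M a))
  | Bin _ e1 e2 =>
      eval_cost M e1 + eval_cost M e2 + bitlen (eval M e1) + bitlen (eval M e2)
  end.

Inductive program :=
  | Skip
  | Store of expr & expr          (* address, value *)
  | Read of expr                  (* address *)
  | Write of expr
  | Then of program & program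
  | If of expr & program & program
  | While of expr & program.

Record state := State {
  cells : memory;
  in_tape : seq nat;
  out_tape : seq nat }.

Definition update (M : memory) (a x : nat) : memory :=
  fun b => if b == a then x else M b.

(* [exec P s c s']: started in [s], [P] halts in [s'] at cost [c]; a test
   succeeds when its value is nonzero, and an exhausted input tape reads 0. *)
Inductive exec : program -> state -> nat -> state -> Prop :=
  | ExecSkip s : exec Skip s 1 s
  | ExecStore a e M i o :
      exec (Store a e) (State M i o)
        (eval_cost M a + eval_cost M e
         + bitlen (eval M a) + bitlen (eval M e))
        (State (update M (eval M a) (eval M e)) i o)
  | ExecRead a M i o :
      exec (Read a) (State M i o)
        (eval_cost M a + bitlen (eval M a) + bitlen (head 0 i))
        (State (update M (eval M a) (head 0 i)) (behead i) o)
  | ExecWrite e M i o :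
      exec (Write e) (State M i o)
        (eval_cost M e + bitlen (eval M e))
        (State M i (rcons o (eval M e)))
  | ExecThen P Q s c s' c' s'' :
      exec P s c s' -> exec Q s' c' s'' ->
      exec (Then P Q) s (c + c') s''
  | ExecIfTrue e P Q s c s' :
      eval (cells s) e != 0 -> exec P s c s' ->
      exec (If e P Q) s (eval_cost (cells s) e + bitlen (eval (cells s) e) + c) s'
  | ExecIfFalse e P Q s c s' :
      eval (cells s) e = 0 -> exec Q s c s' ->
      exec (If e P Q) s (eval_cost (cells s) e + bitlen (eval (cells s) e) + c) s'
  | ExecWhileTrue e P s c s' c' s'' :
      eval (cells s) e != 0 -> exec P s c s' -> exec (While e P) s' c' s'' ->
      exec (While e P) s
        (eval_cost (cells s) e + bitlen (eval (cells s) e) + c + c') s''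
  | ExecWhileFalse e P s :
      eval (cells s) e = 0 ->
      exec (While e P) s (eval_cost (cells s) e + bitlen (eval (cells s) e)) s.

Definition start (i : seq nat) : state := State (fun=> 0) i [::].

Definition encode_seq (T : Type) (enc : T -> seq nat) (s : seq T) : seq nat :=
  size s :: flatten [seq enc x | x <- s].

Definition encode_pair (p : nat * nat) : seq nat := [:: p.1; p.2].

Definition encode_flow (f : flow) : seq nat :=
  [:: demand f, source f & encode_seq encode_pair (steps f)].

(* Weights of valid instances are nonnegative, so [absz] loses no sign. *)
Definition encode_coflow (K : coflow) : seq nat :=
  [:: absz (numq (weight K)), absz (denq (weight K)), release K
    & encode_seq encode_flow (flows K)].

Definition encode_instance (I : instance) : seq nat :=
  nnodes I :: encode_seq encode_pair (edges I)
           ++ encode_seq encode_coflow (coflows I).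

Definition input_size (I : instance) : nat :=
  \sum_(x <- encode_instance I) bitlen x.

(* Demands are given in binary, so a schedule is output in compact form: for
   each flow, a list of pairs [(a, l)], standing for the block of consecutive
   time steps a, a + 1, ..., a + l - 1. *)
Definition compact_schedule := seq (seq (seq (nat * nat))).

Definition expand (C : compact_schedule) : schedule :=
  fun k j => flatten [seq iota b.1 b.2 | b <- nth [::] (nth [::] C k) j].

Definition encode_schedule (C : compact_schedule) : seq nat :=
  encode_seq (encode_seq (encode_seq encode_pair)) C.

Definition halts_with (A : program) (i : seq nat) (c : nat) (o : seq nat) : Prop :=
  exists s, exec A (start i) c s /\ out_tape s = o.

(* The algorithm is only required to work on the instances in [X], and the ratio
   may depend on the instance. *)
Definition approximation_algorithm
    (X : instance -> Prop) (alpha : instance -> rat) (A : program) : Prop :=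
  exists p : {poly nat}, forall I, valid_instance I -> X I ->
    exists c C,
      [/\ halts_with A (encode_instance I) c (encode_schedule C),
          c <= p.[input_size I]%R,
          feasible I (expand C)
        & exists S, optimal I S /\
            (objective I (expand C) <= alpha I * objective I S)%R].

Definition any_release (I : instance) : Prop := True.

Definition small_release (I : instance) : Prop :=
  forall k, k < ncoflows I -> release (coflow_at I k) < max_path I.

(* Main.v *)
Require Import Defs.
From mathcomp Require Import all_boot all_order all_algebra.
From mathcomp Require Import zify ring.
From Stdlib Require Import Classical.

(** Write [L v q] for the total demand of coflow [q] on paths through the node
    [v].  In any feasible schedule the coflows of a set [A] that all complete by
    time [c] have total load at most [c] on [v]; so the completion times satisfy
    the parallel inequalities
    [2 * \sum_(q in A) L v q * C q
       >= \sum_(q in A) L v q ^ 2 + (\sum_(q in A) L v q) ^ 2].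
    A primal-dual rule orders the coflows from the last to the first: take a node
    [v] of maximal load among the remaining coflows, put last the coflow [k]
    minimising [W k / L v k], and lower the other weights [W q] in proportion to
    [L v q].  If [M k] is the maximal load of the coflows up to [k], backward
    induction over the rounds and the inequality of Cauchy and Schwarz give
    [(n + 1) * \sum_k W k * M k <= 2 * n * \sum_k W k * C k].

    The flows are then served greedily in this order.  Each step during which a
    released unfinished flow of [k] is not sent is charged to a node of its path
    that serves a coflow not after [k], and each step during which it is sent is
    charged to all nodes of its path; so [k] completes by
    [r_k + len * M k - (len - 1)], where [len] is the number of nodes.

    The selected flows only change when one of them is finished or a coflow is
    released, hence at most (number of coflows + number of flows) times, and
    between two changes every flow is sent in one block.  Weights are kept as
    integers over an implicit common denominator: a round multiplies them by a
    load, so their bit length grows linearly with the number of rounds. *)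

Set Implicit Arguments.
Unset Strict Implicit.
Unset Printing Implicit Defensive.

Import GRing.Theory.

(** * Structured programs and their cost *)

(** The factor [2n / (n + 1)] arises in a single round. If [T] is the bottleneck load and [S2] the
    sum of the squared loads on that node, then [T ^ 2 <= n * S2], so the parallel inequality
    [S2 + T ^ 2 <= 2 * SC] yields [(n + 1) * T ^ 2 <= 2 * n * SC]. Both claims are met by the same
    program; only the treatment of release times differs. A coflow that sends anything has
    [r_k <= C_k] in every feasible schedule, which costs the additive 1, whereas for [r_k] below the
    maximal path length the saving [len - 1] absorbs [r_k]. The obstacle is the running time, since
    an algorithm is a program charged by bit length. Correctness and cost are separated by a small
    language of arrays and counted loops whose semantics is a total function. Its compiler is proved
    once to run in time polynomial in [N], provided that loop bounds are at most [N] and right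
    factors of stored products have at most [N] bits: each assignment then lengthens numbers by an
    additive amount, never by a factor. What remains is ordinary program verification, with [N] the
    input size. *)

Lemma ltn_bitlen n : n < 2 ^ bitlen n.
Proof. by rewrite /bitlen trunc_log_ltn. Qed.

Lemma bitlen_leq b n : 0 < b -> n < 2 ^ b -> bitlen n <= b.
Proof.
move=> b0; case: n => [_|n lt_n]; first by rewrite /bitlen trunc_log0.
rewrite /bitlen -(ltn_exp2l _ _ (isT : 1 < 2)).
by apply: leq_ltn_trans lt_n; rewrite trunc_logP.
Qed.

Lemma bitlen_gt0 n : 0 < bitlen n. Proof. by []. Qed.

Lemma leq_bitlen m n : m <= n -> bitlen m <= bitlen n.
Proof. by move=> le_mn; apply/bitlen_leq/(leq_ltn_trans le_mn)/ltn_bitlen. Qed.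

Lemma bitlen_self n N : 0 < N -> n <= N -> bitlen n <= N.
Proof.
by move=> N0 le_n; apply/bitlen_leq/(leq_ltn_trans le_n)/ltn_expl.
Qed.

Lemma bitlenM m n : bitlen (m * n) <= bitlen m + bitlen n.
Proof.
by apply: bitlen_leq; rewrite ?addn_gt0 // expnD; apply: ltn_mul; apply: ltn_bitlen.
Qed.

Lemma bitlenD_max m n b :
  bitlen m <= b -> bitlen n <= b -> bitlen (m + n) <= b.+1.
Proof.
move=> lm ln; apply: bitlen_leq => //; rewrite expnS mul2n -addnn -addSn.
have := leq_trans (ltn_bitlen m) (leq_pexp2l (isT : 0 < 2) lm).
have := leq_trans (ltn_bitlen n) (leq_pexp2l (isT : 0 < 2) ln).
by lia.
Qed.

Lemma bitlenD m n : bitlen (m + n) <= bitlen m + bitlen n.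
Proof.
have gm := bitlen_gt0 m; have gn := bitlen_gt0 n.
have /leq_trans := bitlenD_max (leq_maxl (bitlen m) (bitlen n)) (leq_maxr _ _).
by apply; lia.
Qed.

Fixpoint expr_weight (e : expr) : nat :=
  match e with
  | Const n => bitlen n
  | Cell a => (expr_weight a).+1
  | Bin _ e1 e2 => (expr_weight e1 + expr_weight e2).+1
  end.

(** No operation, multiplication included, gives a result longer than its two operands together, so
    the length is linear in [b] with a coefficient read off the syntax. *)
Lemma bitlen_eval M b e :
  0 < b -> (forall x, bitlen (M x) <= b) -> bitlen (eval M e) <= expr_weight e * b.
Proof.
move=> b0 Mb; elim: e => [n|a _|o e1 IH1 e2 IH2] /=; first by rewrite leq_pmulr.
  by rewrite mulSn (leq_trans (Mb _)) ?leq_addr.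
have le2 : bitlen (eval M e1) + bitlen (eval M e2) <= (expr_weight e1 + expr_weight e2).+1 * b.
  by rewrite mulSn mulnDl; lia.
apply: leq_trans le2; case: o => /=.
- exact: bitlenD.
- by rewrite (leq_trans (leq_bitlen (leq_subr _ _))) ?leq_addr.
- exact: bitlenM.
- by rewrite (leq_trans (leq_bitlen (leq_div _ _))) ?leq_addr.
Qed.

(** Each of the at most [expr_weight e] subexpressions is charged for numbers of length
    [O(expr_weight e * b)], whence the square. Two of the three units pay for the cost, the third
    for the length of the result. *)
Lemma eval_cost_leq M b e :
    0 < b -> (forall x, bitlen (M x) <= b) ->
  eval_cost M e + bitlen (eval M e) <= expr_weight e ^ 2 * 3 * b.
Proof.
move=> b0 Mb.
suff: eval_cost M e <= 2 * expr_weight e ^ 2 * b.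
  have := bitlen_eval e b0 Mb; set w := expr_weight e => le1 le2.
  have w0 : 0 < w by rewrite /w; case: (e).
  have : w * b <= w ^ 2 * b by rewrite leq_mul2r expnS leq_pmulr ?expn1 ?orbT.
  by rewrite -!mulnA; lia.
elim: e => [n|a IH|o e1 IH1 e2 IH2] /=.
- by rewrite -mulnA -mulnn mul2n -addnn -!mulnA; nia.
- have := bitlen_eval a b0 Mb; have := Mb (eval M a).
  by set w := expr_weight a in IH *; nia.
have := bitlen_eval e1 b0 Mb; have := bitlen_eval e2 b0 Mb.
by set w1 := expr_weight e1 in IH1 *; set w2 := expr_weight e2 in IH2 *; nia.
Qed.

(** * A language of arrays and counted loops *)

Definition store := nat -> nat -> nat -> nat -> nat.

Identity Coercion store_fun : store >-> Funclass.

(** Array names are compared by [eqn], which computes on literals, so [/=] discards at once every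
    update of another array and leaves index tests only for the array in question. *)
Definition upd (m : store) (a i j l x a' i' j' l' : nat) : nat :=
  if eqn a' a then if [&& i' == i, j' == j & l' == l] then x else m a' i' j' l'
  else m a' i' j' l'.

Arguments upd m a i j l x a' i' j' l' /.

Inductive hexpr :=
  | Lit of nat
  | At of nat & hexpr & hexpr & hexpr
  | Op of binop & hexpr & hexpr.

Fixpoint heval (m : store) (e : hexpr) : nat :=
  match e with
  | Lit n => n
  | At a e1 e2 e3 => m a (heval m e1) (heval m e2) (heval m e3)
  | Op o e1 e2 => binop_fun o (heval m e1) (heval m e2)
  end.

(** The only loop is a counted one whose bound is evaluated once on entry, so every program
    terminates and [run] is defined by plain recursion. *)
Inductive stm :=
  | SSet of nat & hexpr & hexpr & hexpr & hexpr
  | SRead of nat & hexpr & hexpr & hexpr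
  | SPut of hexpr
  | SSeq of stm & stm
  | SIf of hexpr & stm & stm
  | SFor of nat & hexpr & stm.

Record hstate := HState { heap :> store; inp : seq nat; outp : seq nat }.

Definition set_at (s : hstate) a i j l x :=
  HState (upd (heap s) a i j l x) (inp s) (outp s).

Fixpoint run (p : stm) (s : hstate) : hstate :=
  match p with
  | SSet a e1 e2 e3 e =>
      set_at s a (heval s e1) (heval s e2) (heval s e3) (heval s e)
  | SRead a e1 e2 e3 =>
      HState (upd s a (heval s e1) (heval s e2) (heval s e3) (head 0 (inp s)))
             (behead (inp s)) (outp s)
  | SPut e => HState s (inp s) (rcons (outp s) (heval s e))
  | SSeq p q => run q (run p s)
  | SIf e p q => if heval s e != 0 then run p s else run q s
  | SFor x e p => iteri (heval s e) (fun i s' => run p (set_at s' x 0 0 0 i)) s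
  end.

(* Only a product can make a stored number much longer than its operands; it
   lengthens it by at most [N] bits when its right factor has at most [N]. *)
Fixpoint short_factors (N : nat) (m : store) (e : hexpr) : bool :=
  match e with
  | Lit _ | At _ _ _ _ => true
  | Op o e1 e2 =>
      [&& short_factors N m e1, short_factors N m e2
        & if o is Times then bitlen (heval m e2) <= N else true]
  end.

(** The two sources of superpolynomial time are excluded: loops with too many passes, and products
    that make stored numbers explode. Values merely tested, written or used as indices do not stay
    in memory, so stored expressions carry the length condition. *)
Fixpoint safe (N : nat) (p : stm) (s : hstate) : Prop :=
  match p with
  | SSet a e1 e2 e3 e => short_factors N s e
  | SRead _ _ _ _ | SPut _ => True
  | SSeq p q => safe N p s /\ safe N q (run p s)
  | SIf e p q => if heval s e != 0 then safe N p s else safe N q s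
  | SFor x e p =>
      heval s e <= N /\
      forall i, i < heval s e ->
        safe N p (set_at (iteri i (fun i s' => run p (set_at s' x 0 0 0 i)) s) x 0 0 0 i)
  end.

(** * Compilation to the cost model *)

Definition pairing x y := (x + y) * (x + y) + x.

(** With [s = x + y], the value lies between [s ^ 2] and [(s + 1) ^ 2 - 1], so it determines [s] and
    then [x]. The pairing is a polynomial, which lets address expressions compute it. *)
Lemma pairing_inj x y x' y' : pairing x y = pairing x' y' -> x = x' /\ y = y'.
Proof.
rewrite /pairing => eq_p; case: (ltngtP (x + y) (x' + y')) => [lt|lt|eq_s].
- have : (x + y).+1 * (x + y).+1 <= (x' + y') * (x' + y') by rewrite leq_mul.
  by lia.
- have : (x' + y').+1 * (x' + y').+1 <= (x + y) * (x + y) by rewrite leq_mul.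
  by lia.
by move: eq_p; rewrite eq_s; lia.
Qed.

Definition addr a i j l := pairing (pairing (pairing a i) j) l.

Lemma addr_inj a i j l a' i' j' l' : addr a i j l = addr a' i' j' l' ->
  [/\ a = a', i = i', j = j' & l = l'].
Proof. by do 3! case/pairing_inj; move=> *; split. Qed.

Definition pairing_expr e1 e2 :=
  Bin Plus (Bin Times (Bin Plus e1 e2) (Bin Plus e1 e2)) e1.

(* Array [a] of a structured program lives at the addresses of array [a.+1];
   array 0 holds the counters and limits of the enclosing loops. *)
Definition addr_expr a e1 e2 e3 :=
  pairing_expr (pairing_expr (pairing_expr (Const a.+1) e1) e2) e3.

Lemma eval_addr M a e1 e2 e3 :
  eval M (addr_expr a e1 e2 e3) = addr a.+1 (eval M e1) (eval M e2) (eval M e3).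
Proof. by []. Qed.

Fixpoint compile_expr (e : hexpr) : expr :=
  match e with
  | Lit n => Const n
  | At a e1 e2 e3 =>
      Cell (addr_expr a (compile_expr e1) (compile_expr e2) (compile_expr e3))
  | Op o e1 e2 => Bin o (compile_expr e1) (compile_expr e2)
  end.

Definition slot d := Const (addr 0 d 0 0).

(** A loop keeps its counter in [slot d] and its limit in [slot d.+1], and its body is compiled at
    [d.+2]. The truncated difference of the two is nonzero as long as passes remain. The loop
    variable is a fresh copy of the counter in each pass, as in [run], so a body may overwrite
    it. *)
Fixpoint compile (d : nat) (p : stm) : program :=
  match p with
  | SSet a e1 e2 e3 e =>
      Store (addr_expr a (compile_expr e1) (compile_expr e2) (compile_expr e3))
            (compile_expr e)
  | SRead a e1 e2 e3 =>
      Read (addr_expr a (compile_expr e1) (compile_expr e2) (compile_expr e3))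
  | SPut e => Write (compile_expr e)
  | SSeq p q => Then (compile d p) (compile d q)
  | SIf e p q => If (compile_expr e) (compile d p) (compile d q)
  | SFor x e p =>
      Then (Store (slot d.+1) (compile_expr e))
     (Then (Store (slot d) (Const 0))
     (While (Bin Minus (Cell (slot d.+1)) (Cell (slot d)))
        (Then (Store (Const (addr x.+1 0 0 0)) (Cell (slot d)))
        (Then (compile d.+2 p)
              (Store (slot d) (Bin Plus (Cell (slot d)) (Const 1)))))))
  end.

Definition models (M : memory) (m : store) :=
  forall a i j l, M (addr a.+1 i j l) = m a i j l.

Lemma eval_compile M m e : models M m -> eval M (compile_expr e) = heval m e.
Proof.
move=> Mm; elim: e => [//|a e1 IH1 e2 IH2 e3 IH3|o e1 IH1 e2 IH2] /=.
  by rewrite -Mm /addr /pairing IH1 IH2 IH3.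
by rewrite IH1 IH2.
Qed.

Lemma models_upd M m a i j l x :
  models M m -> models (update M (addr a.+1 i j l) x) (upd m a i j l x).
Proof.
move=> Mm a' i' j' l'; rewrite /update /upd Mm -[eqn a' a]/(a' == a).
case: eqP => [/addr_inj[[->] -> -> ->]|neq]; first by rewrite !eqxx.
case: eqP => // ea; case: and3P => // -[/eqP ei /eqP ej /eqP el].
by case: neq; rewrite ea ei ej el.
Qed.

Lemma models_slot M m d x : models M m -> models (update M (addr 0 d 0 0) x) m.
Proof. by move=> Mm a i j l; rewrite /update; case: eqP => // /addr_inj[]. Qed.

Lemma slotE M d x d' :
  update M (addr 0 d 0 0) x (addr 0 d' 0 0) = if d' == d then x else M (addr 0 d' 0 0).
Proof.
rewrite /update; case: (d' =P d) => [->|neq]; first by rewrite eqxx.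
by case: eqP => // /addr_inj[_ /neq].
Qed.

Lemma slot_upd M a i j l x d :
  update M (addr a.+1 i j l) x (addr 0 d 0 0) = M (addr 0 d 0 0).
Proof. by rewrite /update; case: eqP => // /addr_inj[]. Qed.

Fixpoint hexpr_weight (e : hexpr) : nat :=
  match e with
  | Lit n => bitlen n
  | At _ _ _ _ => 1
  | Op _ e1 e2 => (hexpr_weight e1 + hexpr_weight e2).+1
  end.

(** A sum adds one bit to the longer operand and a product at most [N] bits to its left one. The
    increase does not depend on [b]: this is what keeps lengths polynomial when assignments are
    iterated. *)
Lemma bitlen_heval N b (m : store) e :
    0 < N -> (forall a i j l, bitlen (m a i j l) <= b) -> short_factors N m e ->
  bitlen (heval m e) <= b + N * hexpr_weight e.
Proof.
move=> N0 mb; elim: e => [n|a e1 _ e2 _ e3 _|o e1 IH1 e2 IH2] /=.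
- by move=> _; nia.
- by move=> _; rewrite (leq_trans (mb _ _ _ _)) ?leq_addr.
case/and3P=> /IH1 le1 /IH2 le2; case: o => /=.
- move=> _; set B := b + N * (hexpr_weight e1 + hexpr_weight e2).
  have le1B : bitlen (heval m e1) <= B by rewrite /B mulnDr; lia.
  have le2B : bitlen (heval m e2) <= B by rewrite /B mulnDr; lia.
  by apply: leq_trans (bitlenD_max le1B le2B) _; rewrite /B; nia.
- by move=> _; apply: leq_trans (leq_bitlen (leq_subr _ _)) _; nia.
- by move=> le; apply: leq_trans (bitlenM _ _) _; nia.
- by move=> _; apply: leq_trans (leq_bitlen (leq_div _ _)) _; nia.
Qed.

Lemma horner_addn (p q : {poly nat}) x : (p + q).[x]%R = p.[x]%R + q.[x]%R.
Proof. exact: hornerD. Qed.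

Lemma horner_muln (p q : {poly nat}) x : (p * q).[x]%R = p.[x]%R * q.[x]%R.
Proof. exact: hornerM. Qed.

(** Increase of the maximal length of a stored number, in units of [N] bits; a safe loop makes at
    most [N] passes, hence the factor ['X]. *)
Fixpoint growth (p : stm) : {poly nat} :=
  match p with
  | SSet _ _ _ _ e => (hexpr_weight e)%:P
  | SRead _ _ _ _ | SPut _ => 0
  | SSeq p q | SIf _ p q => growth p + growth q
  | SFor _ _ p => 'X * growth p
  end%R.

Definition eval_weight e := expr_weight e ^ 2 * 3.

Definition test_weight d := eval_weight (Bin Minus (Cell (slot d.+1)) (Cell (slot d))).

(** Cost in units of a length [B] that bounds all memory contents reached. The depth [d] enters
    through the slot addresses, which are constants of the program. *)
Fixpoint time (d : nat) (p : stm) : {poly nat} :=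
  match p with
  | SSet a e1 e2 e3 e =>
      (eval_weight (addr_expr a (compile_expr e1) (compile_expr e2) (compile_expr e3))
       + eval_weight (compile_expr e))%N%:P
  | SRead a e1 e2 e3 =>
      (eval_weight (addr_expr a (compile_expr e1) (compile_expr e2) (compile_expr e3))
       + 1)%N%:P
  | SPut e => (eval_weight (compile_expr e))%N%:P
  | SSeq p q => time d p + time d q
  | SIf e p q => (eval_weight (compile_expr e))%N%:P + (time d p + time d q)
  | SFor x e p =>
      (eval_weight (slot d.+1) + eval_weight (compile_expr e)
       + eval_weight (slot d) + eval_weight (Const 0) + test_weight d)%N%:P
      + 'X * ((test_weight d + eval_weight (Const (addr x.+1 0 0 0))
               + eval_weight (Cell (slot d)) + eval_weight (slot d)
               + eval_weight (Bin Plus (Cell (slot d)) (Const 1)))%N%:P + time d.+2 p)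
  end%R.

Lemma eval_cost_bound M b B e : 0 < b -> (forall x, bitlen (M x) <= b) -> b <= B ->
  eval_cost M e + bitlen (eval M e) <= eval_weight e * B.
Proof.
move=> b0 Mb bB; apply: leq_trans (eval_cost_leq e b0 Mb) _.
by rewrite leq_mul2l bB orbT.
Qed.

Lemma bitlen_update M b a x : (forall y, bitlen (M y) <= b) -> bitlen x <= b ->
  forall y, bitlen (update M a x y) <= b.
Proof. by move=> Mb xb y; rewrite /update; case: eqP. Qed.

Definition short_tape N (s : hstate) := all (fun x => bitlen x <= N) (inp s).

(** Slots below [d] belong to the enclosing loops; their preservation lets a loop rely on its
    counter after running its body. Lengths are bounded by [b] at the start, and [B] is the unit of
    cost. *)
Definition simulates N B d p b (s : hstate) M :=
  exists c M',
  [/\ exec (compile d p) (State M (inp s) (outp s)) c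
           (State M' (inp (run p s)) (outp (run p s))),
      models M' (run p s),
      forall d', d' < d -> M' (addr 0 d' 0 0) = M (addr 0 d' 0 0),
      forall x, bitlen (M' x) <= b + N * (growth p).[N]%R
    & c <= (time d p).[N]%R * B /\ short_tape N (run p s)].

Lemma compileP N B p : 0 < N -> forall d b (s : hstate) M,
    N <= b -> b + N * (growth p).[N]%R <= B ->
    models M s -> (forall x, bitlen (M x) <= b) -> short_tape N s -> safe N p s ->
  simulates N B d p b s M.
Proof.
move=> N0; elim: p => [a e1 e2 e3 e|a e1 e2 e3|e|p IHp q IHq|e p IHp q IHq|x e p IHp]
  d b s M Nb bB Ms Mb tp sf.
- have bB' : b <= B by apply: leq_trans bB; rewrite leq_addr.
  have b0 : 0 < b by apply: leq_trans Nb.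
  exists (eval_cost M (addr_expr a (compile_expr e1) (compile_expr e2) (compile_expr e3))
     + eval_cost M (compile_expr e)
     + bitlen (eval M (addr_expr a (compile_expr e1) (compile_expr e2) (compile_expr e3)))
     + bitlen (eval M (compile_expr e))).
  eexists; split; first exact: ExecStore.
  + by rewrite eval_addr !(eval_compile _ Ms); apply: models_upd.
  + by move=> d' _; rewrite eval_addr slot_upd.
  + apply: bitlen_update => [y|]; first by apply: leq_trans (Mb y) _; rewrite leq_addr.
    rewrite (eval_compile _ Ms) hornerC; apply: bitlen_heval => // a' i j l.
    by rewrite -Ms.
  + split=> //; rewrite hornerC mulnDl.
    have := eval_cost_bound (addr_expr a (compile_expr e1) (compile_expr e2) (compile_expr e3)) b0 Mb bB'.
    by have := eval_cost_bound (compile_expr e) b0 Mb bB'; lia.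
- have bB' : b <= B by apply: leq_trans bB; rewrite leq_addr.
  have b0 : 0 < b by apply: leq_trans Nb.
  have hN : bitlen (head 0 (inp s)) <= N.
    by move: tp; rewrite /short_tape; case: (inp s) => //= y l /andP[].
  eexists; eexists; split; first exact: ExecRead.
  + by rewrite eval_addr !(eval_compile _ Ms); apply: models_upd.
  + by move=> d' _; rewrite eval_addr slot_upd.
  + move=> y; apply: (@leq_trans b); last by rewrite leq_addr.
    by apply: bitlen_update => //; apply: leq_trans Nb.
  + split; last by move: tp; rewrite /short_tape /=; case: (inp s) => //= y l /andP[].
    rewrite hornerC mulnDl.
    have := eval_cost_bound (addr_expr a (compile_expr e1) (compile_expr e2) (compile_expr e3)) b0 Mb bB'.
    by rewrite mul1n; lia.
- have bB' : b <= B by apply: leq_trans bB; rewrite leq_addr.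
  have b0 : 0 < b by apply: leq_trans Nb.
  eexists; eexists; split; first by rewrite /= -(eval_compile _ Ms); exact: ExecWrite.
  + by [].
  + by [].
  + by move=> y; apply: leq_trans (Mb y) _; rewrite leq_addr.
  + by split=> //; rewrite hornerC; exact: (eval_cost_bound _ b0 Mb bB').
- case: sf => /= sfp sfq.
  move: bB; rewrite /= horner_addn mulnDr => bB.
  have [|c [M' [ex1 Mp fr1 b1 [t1 tp1]]]] := IHp d b s M Nb _ Ms Mb tp sfp; first by lia.
  have [||c' [M'' [ex2 Mq fr2 b2 [t2 tp2]]]] := IHq d (b + N * (growth p).[N]%R) _ M' _ _ Mp b1 tp1 sfq; [by lia|by lia|].
  exists (c + c'), M''; split=> //.
  + exact: ExecThen ex1 ex2.
  + by move=> d' lt; rewrite fr2 // fr1.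
  + by move=> y; apply: leq_trans (b2 y) _; rewrite /= horner_addn mulnDr; lia.
  + by rewrite /= horner_addn mulnDl leq_add.
- have b0 : 0 < b by apply: leq_trans Nb.
  move: bB; rewrite /= horner_addn mulnDr => bB.
  have bB' : b <= B by lia.
  have ec := eval_cost_bound (compile_expr e) b0 Mb bB'.
  move: sf => /=; rewrite -(eval_compile e Ms) => sf.
  have [ev|ev] := eqVneq (eval M (compile_expr e)) 0.
  + move: sf; rewrite ev /= => sf.
    have [|c [M' [ex Mq fr b1 [t1 tp1]]]] := IHq d b s M Nb _ Ms Mb tp sf; first by lia.
    exists (eval_cost M (compile_expr e) + bitlen (eval M (compile_expr e)) + c), M'.
    rewrite /simulates /= -(eval_compile e Ms) ev /=; split=> //.
    * by rewrite -{1}ev; apply: ExecIfFalse.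
    * by move=> y; apply: leq_trans (b1 y) _; rewrite /= horner_addn mulnDr; lia.
    * by split=> //; rewrite /= !horner_addn hornerC !mulnDl; rewrite ev in ec; lia.
  + move: sf; rewrite ev /= => sf.
    have [|c [M' [ex Mq fr b1 [t1 tp1]]]] := IHp d b s M Nb _ Ms Mb tp sf; first by lia.
    exists (eval_cost M (compile_expr e) + bitlen (eval M (compile_expr e)) + c), M'.
    rewrite /simulates /= -(eval_compile e Ms) ev /=; split=> //.
    * by apply: ExecIfTrue.
    * by move=> y; apply: leq_trans (b1 y) _; rewrite /= horner_addn mulnDr; lia.
    * by split=> //; rewrite /= !horner_addn hornerC !mulnDl; lia.
have b0 : 0 < b by apply: leq_trans Nb.
move: bB sf; rewrite /= horner_muln hornerX.
set n := heval s e; set g := (growth p).[N]%R.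
move=> bB [nN sf].
set S := fun i => iteri i (fun i s' => run p (set_at s' x 0 0 0 i)) s.
set body := (time d.+2 p).[N]%R.
set W := test_weight d + eval_weight (Const (addr x.+1 0 0 0))
               + eval_weight (Cell (slot d)) + eval_weight (slot d)
               + eval_weight (Bin Plus (Cell (slot d)) (Const 1)).
(* Counters are at most [N], so they have at most [N <= b] bits and never raise the length bound. *)
have smallb k i : i <= n -> bitlen i <= b + k.
  by move=> le; rewrite (leq_trans (bitlen_self N0 (leq_trans le nN))) //; lia.
(* Induction on the number [k] of passes left. After [i] passes the stored numbers have grown by at
   most [i * g] units of [N] bits. *)
have loop k : forall i M1, i + k = n -> models M1 (S i) ->
    M1 (addr 0 d 0 0) = i -> M1 (addr 0 d.+1 0 0) = n ->
    (forall y, bitlen (M1 y) <= b + N * (i * g)) -> short_tape N (S i) ->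
  exists c M', [/\ exec (While (Bin Minus (Cell (slot d.+1)) (Cell (slot d)))
        (Then (Store (Const (addr x.+1 0 0 0)) (Cell (slot d)))
        (Then (compile d.+2 p)
              (Store (slot d) (Bin Plus (Cell (slot d)) (Const 1))))))
           (State M1 (inp (S i)) (outp (S i))) c (State M' (inp (S n)) (outp (S n))),
      models M' (S n),
      forall d', d' < d -> M' (addr 0 d' 0 0) = M1 (addr 0 d' 0 0),
      forall y, bitlen (M' y) <= b + N * (n * g)
    & c <= (k * (W + body) + test_weight d) * B /\ short_tape N (S n)].
  elim: k => [|k IHk] i M1 ik M1S ctr lim M1b tp1.
    have -> : n = i by lia.
    have e0 : eval M1 (Bin Minus (Cell (slot d.+1)) (Cell (slot d))) = 0.
      by rewrite /= ctr lim -ik addn0 subnn.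
    set test := Bin Minus _ _ in e0 *.
    exists (eval_cost M1 test + bitlen (eval M1 test)), M1; split=> //.
      exact: (@ExecWhileFalse test _ (State M1 _ _) e0).
    split=> //; rewrite mul0n add0n.
    apply: (@eval_cost_bound _ (b + N * (i * g))) => //; first by lia.
    by apply: leq_trans bB; rewrite leq_add2l !leq_mul2l leq_mul2r; lia.
  have lt_in : i < n by lia.
  have iB : b + N * (i * g) <= B.
    by apply: leq_trans bB; rewrite leq_add2l !leq_mul2l leq_mul2r; lia.
  have iB1 : b + N * (i.+1 * g) <= B.
    by apply: leq_trans bB; rewrite leq_add2l !leq_mul2l leq_mul2r; lia.
  have e1 : eval M1 (Bin Minus (Cell (slot d.+1)) (Cell (slot d))) != 0.
    by rewrite /= ctr lim -lt0n; lia.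
  set M2 := update M1 (addr x.+1 0 0 0) i.
  have M2b : forall y, bitlen (M2 y) <= b + N * (i * g).
    by apply: bitlen_update => //; apply: smallb; lia.
  have M2S : models M2 (set_at (S i) x 0 0 0 i) by apply: models_upd.
  have [||c [M3 [ex3 M3S fr3 b3 [t3 tp3]]]] := IHp d.+2 (b + N * (i * g)) (set_at (S i) x 0 0 0 i)
     M2 _ _ M2S M2b tp1 (sf i lt_in); [by lia| by move: iB1; rewrite mulSn -/g; lia|].
  have b3' y : bitlen (M3 y) <= b + N * (i.+1 * g).
    by apply: leq_trans (b3 y) _; rewrite mulSn -/g; lia.
  have ctr3 : M3 (addr 0 d 0 0) = i by rewrite fr3 // /M2 slot_upd ctr.
  set M4 := update M3 (addr 0 d 0 0) i.+1.
  have [||||||c4 [M5 [ex5 M5S fr5 b5 [t5 tp5]]]] := IHk i.+1 M4.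
  - by rewrite -ik; lia.
  - exact: models_slot.
  - by rewrite /M4 slotE eqxx.
  - by rewrite /M4 slotE eqn_leq ltnn /= fr3 // /M2 slot_upd lim.
  - by apply: bitlen_update => //; apply: smallb.
  - by [].
  have ex2 : exec (Store (Const (addr x.+1 0 0 0)) (Cell (slot d)))
     (State M1 (inp (S i)) (outp (S i)))
     (eval_cost M1 (Const (addr x.+1 0 0 0)) + eval_cost M1 (Cell (slot d))
      + bitlen (eval M1 (Const (addr x.+1 0 0 0))) + bitlen (eval M1 (Cell (slot d))))
     (State M2 (inp (S i)) (outp (S i))).
    have := ExecStore (Const (addr x.+1 0 0 0)) (Cell (slot d)) M1 (inp (S i)) (outp (S i)).
    by rewrite /M2 /= ctr.
  have ex4 : exec (Store (slot d) (Bin Plus (Cell (slot d)) (Const 1)))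
     (State M3 (inp (S i.+1)) (outp (S i.+1)))
     (eval_cost M3 (slot d) + eval_cost M3 (Bin Plus (Cell (slot d)) (Const 1))
      + bitlen (eval M3 (slot d)) + bitlen (eval M3 (Bin Plus (Cell (slot d)) (Const 1))))
     (State M4 (inp (S i.+1)) (outp (S i.+1))).
    have := ExecStore (slot d) (Bin Plus (Cell (slot d)) (Const 1)) M3 (inp (S i.+1)) (outp (S i.+1)).
    by rewrite /M4 /= ctr3 addn1.
  have ex := ExecWhileTrue (s := State M1 (inp (S i)) (outp (S i))) e1 (ExecThen ex2 (ExecThen ex3 ex4)) ex5.
  eexists; exists M5; split; [exact: ex|by []| |by []|split=> //].
  - move=> d' lt; rewrite fr5 // /M4 slotE; case: eqP => [eq|_]; first by lia.
    by rewrite fr3 ?/M2 ?slot_upd //; lia.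
  have c0 : 0 < b + N * (i * g) by lia.
  have c1 : 0 < b + N * (i.+1 * g) by lia.
  have := eval_cost_bound (Bin Minus (Cell (slot d.+1)) (Cell (slot d))) c0 M1b iB.
  have := eval_cost_bound (Const (addr x.+1 0 0 0)) c0 M1b iB.
  have := eval_cost_bound (Cell (slot d)) c0 M1b iB.
  have := eval_cost_bound (slot d) c1 b3' iB1.
  have := eval_cost_bound (Bin Plus (Cell (slot d)) (Const 1)) c1 b3' iB1.
  rewrite -/(test_weight d).
  move: t3 t5; rewrite -/body mulSn /cells !mulnDl; clear; rewrite ?/W ?mulnDl.
  by lia.
have bB' : b <= B by lia.
set M1 := update M (addr 0 d.+1 0 0) n.
have M1b : forall y, bitlen (M1 y) <= b.
  by apply: bitlen_update => //; rewrite -[b]addn0; apply: smallb.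
set M2 := update M1 (addr 0 d 0 0) 0.
have M2b : forall y, bitlen (M2 y) <= b.
  by apply: bitlen_update => //; rewrite -[b]addn0; apply: smallb.
have [||||||c [M3 [ex3 M3S fr3 b3 [t3 tp3]]]] := loop n 0 M2.
- by [].
- by do 2! apply: models_slot.
- by rewrite /M2 slotE eqxx.
- by rewrite /M2 slotE eqn_leq ltnn /= /M1 slotE eqxx.
- by rewrite mul0n muln0 addn0.
- by [].
have ex1 : exec (Store (slot d.+1) (compile_expr e)) (State M (inp s) (outp s))
   (eval_cost M (slot d.+1) + eval_cost M (compile_expr e)
    + bitlen (eval M (slot d.+1)) + bitlen (eval M (compile_expr e)))
   (State M1 (inp s) (outp s)).
  by rewrite /M1 /n -(eval_compile e Ms); apply: ExecStore.
have ex2 : exec (Store (slot d) (Const 0)) (State M1 (inp s) (outp s))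
   (eval_cost M1 (slot d) + eval_cost M1 (Const 0)
    + bitlen (eval M1 (slot d)) + bitlen (eval M1 (Const 0)))
   (State M2 (inp s) (outp s)) by apply: ExecStore.
have ex := ExecThen ex1 (ExecThen ex2 ex3).
eexists; exists M3; split; [exact: ex|exact: M3S| | |].
- move=> d' lt; rewrite fr3 // /M2 slotE; case: eqP => [eq|_]; first by lia.
  by rewrite /M1 slotE; case: eqP => // eq; lia.
- move=> y; apply: leq_trans (b3 y) _.
  rewrite /= horner_muln hornerX -/g.
  by rewrite leq_add2l !leq_mul2l leq_mul2r; lia.
split; last exact: tp3.
rewrite /= horner_addn horner_muln horner_addn hornerX !hornerC -/body -/W.
have : n * (W + body) * B <= N * (W + body) * B by rewrite -!mulnA leq_mul2r nN orbT.
have := eval_cost_bound (slot d.+1) b0 Mb bB'.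
have := eval_cost_bound (compile_expr e) b0 Mb bB'.
have := eval_cost_bound (slot d) b0 M1b bB'.
have := eval_cost_bound (Const 0) b0 M1b bB'.
move: t3; clear; rewrite /= !mulnDl.
by lia.
Qed.

(** Memory is initially 0, so [b = N] is a valid start, and ['X + 'X * growth p] evaluates to the
    length bound [B] reached at the end. *)
Lemma compile_halts N p (s : seq nat) :
    0 < N -> all (fun x => bitlen x <= N) s -> safe N p (HState (fun _ _ _ _ => 0) s [::]) ->
  exists c, halts_with (compile 0 p) s c (outp (run p (HState (fun _ _ _ _ => 0) s [::])))
    /\ c <= (time 0 p * ('X + 'X * growth p)).[N]%R.
Proof.
move=> N0 tp sf.
have [||c [M' [ex _ _ _ [c_le _]]]] :=
  @compileP N (N + N * (growth p).[N]%R) p N0 0 N (HState (fun _ _ _ _ => 0) s [::])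
    (fun=> 0) (leqnn _) (leqnn _) _ _ tp sf.
- by [].
- by move=> x; apply: bitlen_self.
exists c; split; first by eexists; split; first exact: ex.
by rewrite horner_muln horner_addn horner_muln !hornerX.
Qed.

(** * Frame conditions and verification rules *)

Fixpoint mods (p : stm) : seq nat :=
  match p with
  | SSet a _ _ _ _ | SRead a _ _ _ => [:: a]
  | SPut _ => [::]
  | SSeq p q | SIf _ p q => mods p ++ mods q
  | SFor x _ p => x :: mods p
  end.

Fixpoint reads (p : stm) : bool :=
  match p with
  | SRead _ _ _ _ => true
  | SSet _ _ _ _ _ | SPut _ => false
  | SSeq p q | SIf _ p q => reads p || reads q
  | SFor _ _ p => reads p
  end.

Fixpoint writes (p : stm) : bool :=
  match p with
  | SPut _ => true
  | SSet _ _ _ _ _ | SRead _ _ _ _ => false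
  | SSeq p q | SIf _ p q => writes p || writes q
  | SFor _ _ p => writes p
  end.

Definition preserved p (s s' : hstate) :=
  [/\ forall a i j l, a \notin mods p -> s' a i j l = s a i j l,
      reads p || (inp s' == inp s) & writes p || (outp s' == outp s)].

Lemma preserved_refl p s : preserved p s s.
Proof. by split; rewrite ?eqxx ?orbT. Qed.

Lemma preserved_trans p s1 s2 s3 :
  preserved p s1 s2 -> preserved p s2 s3 -> preserved p s1 s3.
Proof.
case=> m1 i1 o1 [m2 i2 o2]; split; first by move=> *; rewrite m2 ?m1.
  by case: (reads p) i1 i2 => //= /eqP <- /eqP ->.
by case: (writes p) o1 o2 => //= /eqP <- /eqP ->.
Qed.

Lemma preserved_sub p q s s' : {subset mods p <= mods q} ->
  (reads p -> reads q) -> (writes p -> writes q) ->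
  preserved p s s' -> preserved q s s'.
Proof.
move=> sub r w [m i o]; split.
- by move=> a i' j l nq; apply: m; apply: contra nq; apply: sub.
- by case: (reads p) r i => [->|_ /=] // ->; rewrite orbT.
by case: (writes p) w o => [->|_ /=] // ->; rewrite orbT.
Qed.

Lemma preserved_set_at p s a i j l x : a \in mods p -> preserved p s (set_at s a i j l x).
Proof.
move=> ap; split=> /=; rewrite ?eqxx ?orbT // => a' i' j' l' na'.
rewrite /upd -[eqn a' a]/(a' == a); case: eqP => // eq.
by rewrite eq ap in na'.
Qed.

Lemma preserved_run p s : preserved p s (run p s).
Proof.
elim: p s => [a e1 e2 e3 e|a e1 e2 e3|e|p IHp q IHq|e p IHp q IHq|x e p IHp] s.
- by apply: preserved_set_at; rewrite inE.
- split=> /=; rewrite ?eqxx ?orbT // => a' i' j' l'; rewrite inE /upd -[eqn a' a]/(a' == a).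
  by case: eqP.
- by split=> //=; rewrite eqxx.
- apply: preserved_trans (preserved_sub _ _ _ (IHp s)) (preserved_sub _ _ _ (IHq _)) => /=.
  + by move=> a; rewrite mem_cat => ->.
  + by move=> ->.
  + by move=> ->.
  + by move=> a; rewrite mem_cat orbC => ->.
  + by move=> ->; rewrite orbT.
  + by move=> ->; rewrite orbT.
- rewrite /=; case: ifP => _; [have := IHp s|have := IHq s]; apply: preserved_sub => /=.
  + by move=> a; rewrite mem_cat => ->.
  + by move=> ->.
  + by move=> ->.
  + by move=> a; rewrite mem_cat orbC => ->.
  + by move=> ->; rewrite orbT.
  + by move=> ->; rewrite orbT.
rewrite /=; elim: (heval s e) => [|n IHn] /=; first exact: preserved_refl.
apply: preserved_trans IHn _; set s' := iteri _ _ _.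
apply: (@preserved_trans _ _ (set_at s' x 0 0 0 n)).
  by apply: preserved_set_at; rewrite inE eqxx.
apply: preserved_sub (IHp _) => //= a; rewrite inE => ->.
by rewrite orbT.
Qed.

Definition wp N p s (Q : hstate -> Prop) := safe N p s /\ Q (run p s).

(** Each use of a specification also delivers the frame condition, so specifications mention only
    what a program changes. *)
Lemma wp_conseq N p (s : hstate) (Q Q' : hstate -> Prop) :
  wp N p s Q' -> (forall s', preserved p s s' -> Q' s' -> Q s') -> wp N p s Q.
Proof. by case=> sf q imp; split=> //; apply: imp => //; apply: preserved_run. Qed.

Lemma wp_seq N p q s Q : wp N p s (fun s' => wp N q s' Q) -> wp N (SSeq p q) s Q.
Proof. by case=> sfp [sfq Qs]; split. Qed.

Lemma wp_set N a e1 e2 e3 e (s : hstate) (Q : hstate -> Prop) : short_factors N s e ->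
    Q (set_at s a (heval s e1) (heval s e2) (heval s e3) (heval s e)) ->
  wp N (SSet a e1 e2 e3 e) s Q.
Proof. by []. Qed.

Lemma wp_read N a e1 e2 e3 (s : hstate) (Q : hstate -> Prop) :
    Q (HState (upd s a (heval s e1) (heval s e2) (heval s e3) (head 0 (inp s)))
              (behead (inp s)) (outp s)) ->
  wp N (SRead a e1 e2 e3) s Q.
Proof. by []. Qed.

Lemma wp_put N e (s : hstate) (Q : hstate -> Prop) :
  Q (HState s (inp s) (rcons (outp s) (heval s e))) -> wp N (SPut e) s Q.
Proof. by []. Qed.

Lemma wp_if N e p q (s : hstate) Q :
    (0 < heval s e -> wp N p s Q) -> (heval s e = 0 -> wp N q s Q) ->
  wp N (SIf e p q) s Q.
Proof.
rewrite /wp /= -lt0n; case: ltnP => [_ /(_ isT)//|]; rewrite leqn0 => /eqP e0 _.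
exact.
Qed.

(** Besides the invariant [J], the postcondition may use the whole sequence of states between
    passes, with consecutive ones related by [R]. The primal-dual rounds and the greedy events are
    analysed as such sequences, which the last state alone does not determine. *)
Lemma wp_for_hist N x e p (s : hstate) n (J : nat -> hstate -> Prop)
    (R : nat -> hstate -> hstate -> Prop) (Q : hstate -> Prop) :
    heval s e = n -> n <= N -> J 0 s ->
    (forall i s', i < n -> preserved (SFor x e p) s s' -> J i s' ->
       wp N p (set_at s' x 0 0 0 i) (fun s'' => J i.+1 s'' /\ R i s' s'')) ->
    (forall st : nat -> hstate, st 0 = s ->
       (forall i, i <= n -> preserved (SFor x e p) s (st i) /\ J i (st i)) ->
       (forall i, i < n -> R i (st i) (st i.+1)) -> Q (st n)) ->
  wp N (SFor x e p) s Q.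
Proof.
move=> en nN J0 body fin.
set S := fun i => iteri i (fun i s' => run p (set_at s' x 0 0 0 i)) s.
have SJ i : i <= n -> preserved (SFor x e p) s (S i) /\ J i (S i).
  elim: i => [|i IH] lt; first by split=> //; apply: preserved_refl.
  have [pr Ji] := IH (ltnW lt); have [_ [J' _]] := body i (S i) lt pr Ji.
  split=> //; apply: preserved_trans pr _.
  apply: (@preserved_trans _ _ (set_at (S i) x 0 0 0 i)).
    by apply: preserved_set_at; rewrite inE eqxx.
  apply: preserved_sub (preserved_run _ _) => //= a; rewrite inE => ->.
  by rewrite orbT.
split=> /=.
  rewrite en; split=> // i lt; have [pr Ji] := SJ i (ltnW lt).
  by case: (body i _ lt pr Ji).
rewrite en; apply: (fin S) => // i lt; have [pr Ji] := SJ i (ltnW lt).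
by case: (body i _ lt pr Ji) => _ [].
Qed.

Lemma wp_for N x e p (s : hstate) n (J : nat -> hstate -> Prop) (Q : hstate -> Prop) :
    heval s e = n -> n <= N -> J 0 s ->
    (forall i s', i < n -> preserved (SFor x e p) s s' -> J i s' ->
       wp N p (set_at s' x 0 0 0 i) (J i.+1)) ->
    (forall s', preserved (SFor x e p) s s' -> J n s' -> Q s') ->
  wp N (SFor x e p) s Q.
Proof.
move=> en nN J0 body fin.
apply: (@wp_for_hist _ _ _ _ _ n J (fun _ _ _ => True)) => // [i s' lt pr Ji|st _ SJ _].
  by apply: wp_conseq (body i s' lt pr Ji) _.
by have [pr Jn] := SJ n (leqnn _); apply: fin.
Qed.

(** * Reading the instance *)

Notation vJunk := 0.
Notation vE := 1.
Notation vN := 2.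
Notation vT := 3.
Notation vL := 4.
Notation vI := 5.
Notation vK := 6.
Notation vJ := 7.
Notation vP := 8.
Notation vQ := 9.
Notation aNum := 10.
Notation aDen := 11.
Notation aRel := 12.
Notation aNf := 13.
Notation aDem := 14.
Notation aLen := 15.
Notation aNode := 16.
Notation aW := 17.
Notation aAct := 18.
Notation aLoad := 19.
Notation vBest := 20.
Notation vBv := 21.
Notation vTot := 22.
Notation vPick := 23.
Notation vFac := 24.
Notation vWt := 25.
Notation aOrd := 26.
Notation aPos := 27.
Notation vS := 28.
Notation vTime := 29.
Notation vDl := 30.
Notation vEv := 31.
Notation aDone := 32.
Notation aMark := 33.
Notation aOut := 34.
Notation aSt := 35.
Notation vFree := 36.
Notation vGap := 37.

Definition var x := At x (Lit 0) (Lit 0) (Lit 0).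
Definition at1 a e := At a e (Lit 0) (Lit 0).
Definition at2 a e1 e2 := At a e1 e2 (Lit 0).
Definition put0 x e := SSet x (Lit 0) (Lit 0) (Lit 0) e.
Definition put1 a e1 e := SSet a e1 (Lit 0) (Lit 0) e.
Definition put2 a e1 e2 e := SSet a e1 e2 (Lit 0) e.
Definition read0 x := SRead x (Lit 0) (Lit 0) (Lit 0).
Definition read1 a e1 := SRead a e1 (Lit 0) (Lit 0).
Definition skip := put0 vJunk (Lit 0).

Notation "p ;; q" := (SSeq p q) (at level 90, right associativity).
Notation "e1 [+] e2" := (Op Plus e1 e2) (at level 50, left associativity).
Notation "e1 [-] e2" := (Op Minus e1 e2) (at level 50, left associativity).
Notation "e1 [*] e2" := (Op Times e1 e2) (at level 40, left associativity).

Definition read_flow :=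
  SRead aDem (var vK) (var vJ) (Lit 0) ;;
  SRead aNode (var vK) (var vJ) (Lit 0) ;;
  read0 vL ;;
  put2 aLen (var vK) (var vJ) (var vL [+] Lit 1) ;;
  SFor vP (var vL)
    (read0 vJunk ;; SRead aNode (var vK) (var vJ) (var vP [+] Lit 1)).

Definition read_coflow :=
  read1 aNum (var vK) ;;
  read1 aDen (var vK) ;;
  read1 aRel (var vK) ;;
  read1 aNf (var vK) ;;
  SFor vJ (at1 aNf (var vK)) (put0 vT (var vT [+] Lit 1) ;; read_flow).

(** [vT] ends up as the number of coflows plus the number of flows, which later serves as the number
    of greedy events. *)
Definition read_instance :=
  read0 vJunk ;;
  read0 vE ;;
  SFor vI (var vE) (read0 vJunk ;; read0 vJunk) ;;
  read0 vN ;;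
  put0 vT (var vN) ;;
  SFor vK (var vN) read_coflow.

(** The rest of the tape is tracked here once and for all: a body only has to consume its own item
    and restore [J]. *)
Lemma wp_read_seq (T : Type) (enc : T -> seq nat) (x0 : T) N x e p (s : hstate)
    (xs : seq T) rest (J : nat -> hstate -> Prop) (Q : hstate -> Prop) :
    heval s e = size xs -> size xs <= N -> inp s = flatten (map enc xs) ++ rest -> J 0 s ->
    (forall i s' rest', i < size xs -> preserved (SFor x e p) s s' -> J i s' ->
       inp s' = enc (nth x0 xs i) ++ rest' ->
       wp N p (set_at s' x 0 0 0 i) (fun s'' => J i.+1 s'' /\ inp s'' = rest')) ->
    (forall s', preserved (SFor x e p) s s' -> J (size xs) s' -> inp s' = rest -> Q s') ->
  wp N (SFor x e p) s Q.
Proof.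
move=> en nN tp J0 body fin.
apply: (@wp_for _ _ _ _ _ (size xs)
  (fun i s' => J i s' /\ inp s' = flatten (map enc (drop i xs)) ++ rest)) => //.
- by rewrite drop0.
- move=> i s' lt pr [Ji]; rewrite (drop_nth x0) //= -catA => tp'.
  exact: wp_conseq (body i s' _ lt pr Ji tp') _.
by move=> s' pr [Jn]; rewrite drop_size; apply: fin.
Qed.

Definition flow_read (s : hstate) k j f :=
  [/\ s aDem k j 0 = demand f, s aLen k j 0 = size (nodes f)
    & forall p, p < size (nodes f) -> s aNode k j p = nth 0 (nodes f) p].

Definition coflow_read (s : hstate) k K :=
  [/\ s aNum k 0 0 = absz (numq (weight K)), s aDen k 0 0 = absz (denq (weight K)),
      s aRel k 0 0 = release K, s aNf k 0 0 = size (flows K)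
    & forall j, j < size (flows K) -> flow_read s k j (nth (Flow 0 0 [::]) (flows K) j)].

Definition instance_read I (s : hstate) :=
  [/\ s vN 0 0 0 = ncoflows I,
      s vT 0 0 0 = ncoflows I + \sum_(k < ncoflows I) nflows I k
    & forall k, k < ncoflows I -> coflow_read s k (coflow_at I k)].

(** All flows share the arrays [aDem], [aLen] and [aNode], about which the frame condition is
    silent; the last clause protects the flows read before. *)
Lemma read_flowP N (s : hstate) f rest k j :
    inp s = encode_flow f ++ rest -> size (steps f) <= N ->
    s vK 0 0 0 = k -> s vJ 0 0 0 = j ->
  wp N read_flow s (fun s' => [/\ flow_read s' k j f, inp s' = rest
    & forall k' j' f', (k' == k) && (j' == j) = false ->
      flow_read s k' j' f' -> flow_read s' k' j' f']).
Proof.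
move=> tp le ek ej; do 3! [apply/wp_seq/wp_read]; apply/wp_seq/wp_set => //=.
rewrite tp /= ek ej.
set s0 := set_at _ _ _ _ _ _.
apply: (@wp_read_seq _ encode_pair (0, 0) _ _ _ _ _ (steps f) rest
  (fun i s' => (forall p, p <= i -> s' aNode k j p = nth 0 (nodes f) p) /\
     forall k' j' l, (k' == k) && (j' == j) = false ->
       s' aNode k' j' l = s aNode k' j' l)) => //.
- rewrite /s0 /=; split; first by case=> //= _; rewrite !eqxx.
  by move=> k' j' l neq; rewrite ?andbA neq.
- move=> i s' rest' lt [fr _ _] [nd oth] tp'; apply/wp_seq/wp_read/wp_read.
  have fk : s' vK 0 0 0 = k by rewrite fr.
  have fj : s' vJ 0 0 0 = j by rewrite fr.
  rewrite /= tp' /= fk fj; split=> //; split.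
  + move=> p le_p /=; rewrite !eqxx /= addn1; case: eqP => [->|np].
      by rewrite /nodes /= (nth_map (0, 0)).
    by apply: nd; lia.
  + by move=> k' j' l neq; rewrite ?andbA neq /= oth.
move=> s' [fr _ _] [nd oth] tp'; split=> //.
  by split; rewrite ?fr /s0 //= ?eqxx /= ?size_map ?addn1 // size_map.
move=> k' j' f' neq [dm ln nd']; split; rewrite ?fr /s0 //= ?andbA ?neq //=.
by move=> p lt; rewrite oth // nd'.
Qed.

Lemma read_coflowP N (s : hstate) K rest k :
    inp s = encode_coflow K ++ rest -> size (flows K) <= N ->
    (forall j, j < size (flows K) -> size (steps (nth (Flow 0 0 [::]) (flows K) j)) <= N) ->
    s vK 0 0 0 = k ->
  wp N read_coflow s (fun s' => [/\ coflow_read s' k K, inp s' = rest,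
      s' vT 0 0 0 = s vT 0 0 0 + size (flows K)
    & forall k' K', (k' == k) = false -> coflow_read s k' K' -> coflow_read s' k' K']).
Proof.
move=> tp le leN ek; do 4! [apply/wp_seq/wp_read] => /=.
rewrite tp /= ek.
set s0 := HState _ _ _.
apply: (@wp_read_seq _ encode_flow (Flow 0 0 [::]) _ _ _ _ _ (flows K) rest
  (fun j s' => [/\ forall j', j' < j -> flow_read s' k j' (nth (Flow 0 0 [::]) (flows K) j'),
     s' vT 0 0 0 = s vT 0 0 0 + j
   & forall k' j' f', (k' == k) = false -> flow_read s k' j' f' -> flow_read s' k' j' f'])) => //.
- by rewrite /= ek eqxx.
- by split=> //=; rewrite addn0.
- move=> j s' rest' lt [fr _ _] [fl eT oth] tp'; apply/wp_seq/wp_set => //=.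
  have fk : s' vK 0 0 0 = k by rewrite fr.
  apply: wp_conseq; first by apply: (@read_flowP _ _ (nth (Flow 0 0 [::]) (flows K) j) rest' k j) => //; apply: leN.
  move=> s'' [fr' _ _] [fl' tp'' oth']; split=> //; split.
  + move=> j'; rewrite ltnS leq_eqVlt; case: eqP => [->//|/eqP neq /= lt'].
    by apply: oth'; rewrite ?(negbTE neq) ?andbF //; apply: fl.
  + by rewrite fr' //= eT addn1 addnS.
  + by move=> k' j' f' neq /(oth _ _ _ neq) fl''; apply: oth' => //; rewrite neq.
move=> s' [fr _ _] [fl eT oth] tp'; split=> //.
  by split; rewrite ?fr //= ?eqxx.
by move=> k' K' neq [a1 a2 a3 a4 fl']; split; rewrite ?fr //= ?neq // => j lt;
  apply: oth => //; apply: fl'.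
Qed.

Lemma read_instanceP N (s : hstate) I rest :
    inp s = encode_instance I ++ rest -> size (edges I) <= N -> ncoflows I <= N ->
    (forall k, k < ncoflows I -> nflows I k <= N) ->
    (forall k j, is_flow I k j -> size (steps (flow_at I k j)) <= N) ->
  wp N read_instance s (fun s' => instance_read I s').
Proof.
move=> tp leE leN leF leS; apply/wp_seq/wp_read/wp_seq/wp_read/wp_seq => /=.
rewrite tp /= -catA.
apply: (@wp_read_seq _ encode_pair (0, 0) _ _ _ _ _ (edges I)
  (encode_seq encode_coflow (coflows I) ++ rest) (fun _ _ => True)) => //.
  by move=> i s' rest' lt _ _ tp'; apply/wp_seq/wp_read/wp_read; rewrite /= tp'.
move=> {tp}s1 _ _ tp; apply/wp_seq/wp_read/wp_seq/wp_set => //=; rewrite tp /=.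
apply: (@wp_read_seq _ encode_coflow (Coflow 0%R 0 [::]) _ _ _ _ _ (coflows I) rest
  (fun k s' => s' vT 0 0 0 = ncoflows I + \sum_(i < k) nflows I i /\
     forall k', k' < k -> coflow_read s' k' (coflow_at I k'))) => //.
- by rewrite /= big_ord0 addn0.
- move=> k s' rest' lt [fr _ _] [eT cf] tp'.
  apply: wp_conseq; first (apply: (@read_coflowP _ _ (coflow_at I k) rest' k) => //; first exact: leF).
    by move=> j ltj; apply: leS; rewrite /is_flow /ncoflows lt.
  move=> s'' _ [cf' tp'' eT' oth]; split=> //; split.
    by rewrite eT' /= eT big_ord_recr addnA.
  move=> k'; rewrite ltnS leq_eqVlt; case: eqP => [->//|/eqP neq /= lt'].
  by apply: oth; rewrite ?(negbTE neq) //; apply: cf.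
by move=> s' [fr _ _] [eT cf] _; split=> //; rewrite fr.
Qed.

(** * Loads and integer weights *)

Definition load I v k : nat :=
  \sum_(j < nflows I k) (v \in nodes (flow_at I k j)) * demand (flow_at I k j).

Definition num I k := absz (numq (weight (coflow_at I k))).
Definition den I k := absz (denq (weight (coflow_at I k))).

(* The weights, multiplied by their common denominator. *)
Definition int_weight I k : nat :=
  \prod_(j < ncoflows I) if j == k :> nat then num I j else den I j.

(** All that the safety of the program asks of an instance, to be used with [N = input_size I];
    [fits_uniq] also serves the correctness of the loads. *)
Record fits N I : Prop := Fits {
  fits_pos : 0 < N;
  fits_edges : size (edges I) <= N;
  fits_events : ncoflows I + \sum_(k < ncoflows I) nflows I k <= N;
  fits_nflows : forall k, k < ncoflows I -> nflows I k <= N;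
  fits_num : forall k, k < ncoflows I -> bitlen (num I k) <= N;
  fits_den : forall k, k < ncoflows I -> bitlen (den I k) <= N;
  fits_nodes : forall k j, is_flow I k j -> size (nodes (flow_at I k j)) <= N;
  fits_load : forall v k, bitlen (load I v k) <= N;
  fits_uniq : forall k j, is_flow I k j -> uniq (nodes (flow_at I k j)) }.

Lemma fits_ncoflows N I : fits N I -> ncoflows I <= N.
Proof. by move/fits_events; apply: leq_trans; rewrite leq_addr. Qed.

(** The sum of the two truncated differences is nonzero exactly when the indices differ. A single
    numerator or denominator stands as right factor of each product, which therefore counts as
    short. *)
Definition set_weights :=
  SFor vK (var vN) (
    put1 aW (var vK) (Lit 1) ;;
    put1 aAct (var vK) (Lit 1) ;;
    SFor vJ (var vN) (
      SIf ((var vJ [-] var vK) [+] (var vK [-] var vJ))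
        (put1 aW (var vK) (at1 aW (var vK) [*] at1 aDen (var vJ)))
        (put1 aW (var vK) (at1 aW (var vK) [*] at1 aNum (var vJ))))).

Definition set_loads :=
  SFor vK (var vN) (SFor vJ (at1 aNf (var vK)) (SFor vP (at2 aLen (var vK) (var vJ)) (
    put2 aLoad (At aNode (var vK) (var vJ) (var vP)) (var vK)
      (at2 aLoad (At aNode (var vK) (var vJ) (var vP)) (var vK)
       [+] at2 aDem (var vK) (var vJ))))).

Lemma instance_read_preserved I (s s' : hstate) p : preserved p s s' ->
    instance_read I s -> all (fun a => a \notin mods p) 
      [:: vN; vT; aNum; aDen; aRel; aNf; aDem; aLen; aNode] ->
  instance_read I s'.
Proof.
move=> [fr _ _] [en eT rd] /=.
case/andP=> n2 /andP[n3] /andP[n10] /andP[n11] /andP[n12] /andP[n13] /andP[n14] /andP[n15] /andP[n16] _.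
split; rewrite ?fr // => k lt; have [a b c d fl] := rd k lt.
split; rewrite ?fr // => j ltj; have [a' b' c'] := fl j ltj.
by split; rewrite ?fr // => q ltq; rewrite fr // c'.
Qed.

Lemma instance_read_flow I s k j : instance_read I s -> is_flow I k j ->
  [/\ s aDem k j 0 = demand (flow_at I k j), s aLen k j 0 = size (nodes (flow_at I k j))
    & forall p, p < size (nodes (flow_at I k j)) -> s aNode k j p = nth 0 (nodes (flow_at I k j)) p].
Proof.
by move=> [_ _ rd] /andP[/rd[_ _ _ _ fl]]; apply: fl.
Qed.

Lemma instance_read_nf I s k : instance_read I s -> k < ncoflows I -> s aNf k 0 0 = nflows I k.
Proof. by move=> [_ _ rd] /rd[]. Qed.

Lemma set_weightsP N I (s : hstate) : fits N I -> instance_read I s ->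
  wp N set_weights s (fun s' =>
    forall k, k < ncoflows I -> s' aW k 0 0 = int_weight I k /\ s' aAct k 0 0 = 1).
Proof.
move=> fi rd; have nN := fits_ncoflows fi; have [en _ _] := rd.
apply: (@wp_for _ _ _ _ _ (ncoflows I) (fun i s' =>
  forall k, k < i -> s' aW k 0 0 = int_weight I k /\ s' aAct k 0 0 = 1)) => //.
move=> k s' lt pr IH; apply/wp_seq/wp_set => //; apply/wp_seq/wp_set => //=.
have rd' := instance_read_preserved pr rd isT; have [en' _ _] := rd'.
apply: (@wp_for _ _ _ _ _ (ncoflows I) (fun i s'' =>
  [/\ forall k', k' < k -> s'' aW k' 0 0 = int_weight I k' /\ s'' aAct k' 0 0 = 1,
      s'' aW k 0 0 = \prod_(j < i) (if j == k :> nat then num I j else den I j)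
    & s'' aAct k 0 0 = 1])) => //.
- split=> /=; rewrite ?eqxx ?big_ord0 // => k' ltk.
  by rewrite ltn_eqF //; apply: IH.
- move=> j s'' ltj [fr _ _] [IHk IHw IHa].
  have [_ _ /(_ _ ltj)[enum eden _ _ _]] := rd'.
  have fk : s'' vK 0 0 0 = k by rewrite fr.
  have fnum : s'' aNum j 0 0 = num I j by rewrite fr //=.
  have fden : s'' aDen j 0 0 = den I j by rewrite fr //=.
  apply: wp_if => /= cmp; apply: wp_set => /=; rewrite ?fk ?fnum ?fden.
  + exact: fits_den.
  + split=> //=.
    * by move=> k' ltk; rewrite ltn_eqF //; apply: IHk.
    * rewrite !eqxx big_ord_recr /= IHw; case: eqP => // eq.
      by move: cmp; rewrite fk eq; lia.
  + exact: fits_num.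
  + split=> //=.
    * by move=> k' ltk; rewrite ltn_eqF //; apply: IHk.
    * rewrite !eqxx big_ord_recr /= IHw; case: eqP => // eq.
      by move: cmp; rewrite fk; lia.
move=> s'' [fr _ _] [IHk IHw IHa] k'; rewrite ltnS leq_eqVlt.
by case: eqP => [->//|_ /= /IHk].
Qed.

Lemma set_loadsP N I (s : hstate) : fits N I -> instance_read I s ->
    (forall v k, s aLoad v k 0 = 0) ->
  wp N set_loads s (fun s' =>
    forall v k, s' aLoad v k 0 = if k < ncoflows I then load I v k else 0).
Proof.
move=> fi rd s0; have nN := fits_ncoflows fi; have [en _ _] := rd.
apply: (@wp_for _ _ _ _ _ (ncoflows I) (fun i s' =>
  forall v k, s' aLoad v k 0 = if k < i then load I v k else 0)) => //.
move=> k s1 ltk pr IH; have rd1 := instance_read_preserved pr rd isT.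
apply: (@wp_for _ _ _ _ _ (nflows I k) (fun j s' =>
  forall v k', s' aLoad v k' 0 = if k' < k then load I v k' else
    if k' == k then \sum_(j' < j) (v \in nodes (flow_at I k j')) * demand (flow_at I k j')
    else 0)).
- by rewrite /= (instance_read_nf rd1).
- exact: (fits_nflows fi ltk).
- by move=> v k'; rewrite big_ord0 if_same /= IH.
- move=> j s2 ltj pr2 IHj.
  have fl : is_flow I k j by rewrite /is_flow ltk ltj.
  have rd2 := instance_read_preserved pr2 rd1 isT.
  have [edem elen enode] := instance_read_flow rd2 fl.
  have fk : s2 vK 0 0 0 = k by have [fr _ _] := pr2; rewrite fr.
  set dm := demand (flow_at I k j) in edem *.
  move: elen enode (fits_uniq fi fl) (fits_nodes fi fl).
  move: {-1}(nodes (flow_at I k j)) (erefl (nodes (flow_at I k j))) => nd end_ elen enode un le_nd.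
  apply: (@wp_for _ _ _ _ _ (size nd) (fun p s' =>
    forall v k', s' aLoad v k' 0 = if k' < k then load I v k' else
      if k' == k then
        \sum_(j' < j) (v \in nodes (flow_at I k j')) * demand (flow_at I k j') + (v \in take p nd) * dm
      else 0)).
  + by rewrite /= fk elen.
  + by [].
  + by move=> v k'; rewrite take0 mul0n addn0 /= IHj.
  + move=> p s3 ltp pr3 IHp; have [fr3 _ _] := pr3.
    have edem3 : s3 aDem k j 0 = dm by rewrite fr3.
    have enode3 : s3 aNode k j p = nth 0 nd p by rewrite fr3 //= enode.
    have fk3 : s3 vK 0 0 0 = k by rewrite fr3.
    have fj3 : s3 vJ 0 0 0 = j by rewrite fr3 //= .
    apply: wp_set => //= v k'.
    rewrite fk3 fj3 enode3 edem3 !IHp ltnn eqxx.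
    rewrite (take_nth 0) // mem_rcons inE.
    (* A path visits no node twice, so the flow adds its demand to this node only now, in accordance
       with the 0/1 factor in [load]. *)
    have nin : nth 0 nd p \notin take p nd.
      by move: un; rewrite -{1}(cat_take_drop p.+1 nd) cat_uniq (take_nth 0) // rcons_uniq => /andP[/andP[]].
    case: (v =P _) => [->|nv]; rewrite ?andbT /=; last by case: (ltngtP k' k).
    rewrite eqxx (negbTE nin) mul0n addn0 mul1n.
    by case: (ltngtP k' k).
  move=> s3 _ IHp v k'; rewrite IHp take_size big_ord_recr /=.
  by rewrite end_.
move=> s2 _ IHj v k'; rewrite IHj ltnS.
by case: (ltngtP k' k) => // ->.
Qed.

(** * The primal-dual order *)

(** Obtained by summing [2 * (a i * a j) <= a i ^ 2 + a j ^ 2] over all pairs. *)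
Lemma sqr_sum_leq n (P : pred 'I_n) (a : 'I_n -> nat) :
  (\sum_(i | P i) a i) ^ 2 <= n * \sum_(i | P i) a i ^ 2.
Proof.
have card_le : \sum_(i | P i) 1 <= n.
  by rewrite sum1_card -[leqRHS]card_ord max_card.
rewrite -(leq_pmul2l (isT : 0 < 2)) expnS expn1 big_distrlr /= big_distrr /=.
apply: (@leq_trans (\sum_(i | P i) \sum_(j | P j) (a i ^ 2 + a j ^ 2))).
  apply: leq_sum => i _; rewrite big_distrr /=; apply: leq_sum => j _.
  exact: nat_Cauchy.
under eq_bigr => i _ do rewrite big_split /=.
rewrite big_split /= exchange_big /= addnn -mul2n leq_mul2l /=.
under eq_bigr => i _ do rewrite -[\sum_(j | P j) _]mul1n.
by rewrite -big_distrl /= leq_mul2r card_le orbT.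
Qed.

(* Node [v] serves one unit at a time: the jobs of [A] all complete by [c], so
   their total load on [v] is at most [c]. *)
Definition capacity n (L : nat -> nat -> nat) (C : nat -> nat) :=
  forall v (A : pred 'I_n) c,
    (forall q, A q -> C q <= c) -> \sum_(q < n | A q) L v q <= c.

(* The parallel inequalities of concurrent open shop scheduling. *)
Lemma weighted_completion_lower n L C v (A : pred 'I_n) : capacity n L C ->
  \sum_(q | A q) L v q ^ 2 + (\sum_(q | A q) L v q) ^ 2
    <= 2 * \sum_(q | A q) L v q * C q.
Proof.
move=> cap; move: {2}#|A| (leqnn #|A|) => m; elim: m A => [|m IH] A leA.
  have A0 q : A q = false.
    by move: leA; rewrite leqn0 => /eqP/card0_eq/(_ q); rewrite unfold_in.
  by rewrite !(eq_bigl _ _ A0) !big_pred0_eq.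
case: (pickP A) => [q0 Aq0|A0]; last by rewrite !(eq_bigl _ _ A0) !big_pred0_eq.
(* Remove the job [k] that completes last. With [a] its load and [T] the load of the others, its
   removal lowers the left side by exactly [2 * a * (a + T)], and capacity at time [C k] gives
   [a + T <= C k]. *)
have [k Ak kmax] : exists2 k, A k & forall q, A q -> C q <= C k.
  by case: (arg_maxnP (fun q : 'I_n => C q) Aq0) => k Ak kmax; exists k.
have := cap v A (C k) kmax.
rewrite !(bigD1 k Ak) /=.
have := IH (fun q => A q && (q != k)).
have -> : #|(fun q => A q && (q != k)) : pred 'I_n| <= m.
  move: leA; rewrite (cardD1 k) [k \in A]Ak add1n ltnS; apply: leq_trans.
  by apply/subset_leq_card/subsetP => q; rewrite !inE !unfold_in andbC.
move/(_ isT); set a := L v k; set T := \sum_(_ < n | _) L v _.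
set S2 := \sum_(_ < n | _) _ ^ 2; set SC := \sum_(_ < n | _) _ * _.
by nia.
Qed.

(** [act s] is the set of jobs left at the start of round [s], and [k s] is the job taken out in
    that round. *)
Definition removal n (act : nat -> nat -> bool) (k : nat -> nat) :=
  [/\ forall q, q < n -> act 0 q, forall s, s < n -> k s < n /\ act s (k s)
    & forall s q, s < n -> q < n -> act s.+1 q = act s q && (q != k s)].

Lemma removal_card n act k s : removal n act k -> s <= n ->
  \sum_(q < n | act s q) 1 = n - s.
Proof.
case=> act0 kP actS; elim: s => [_|s IH lt].
  rewrite subn0 -[RHS]card_ord -sum1_card; apply: eq_bigl => q.
  by rewrite act0.
have [kn ak] := kP s lt; have := IH (ltnW lt).
rewrite (bigD1 (Ordinal kn)) //= => eq.
rewrite (eq_bigl (fun q : 'I_n => act s q && (q != Ordinal kn))).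
  by rewrite subnS -eq add1n.
by move=> q; rewrite actS.
Qed.

Lemma removal_last n act k q : removal n act k -> q < n -> act n q = false.
Proof.
move=> rem lt; apply/negP => aq; have := removal_card rem (leqnn _).
by rewrite (bigD1 (Ordinal lt)) //= subnn.
Qed.

Lemma removal_act n act k s s' : removal n act k -> s <= n -> s' < n ->
  act s (k s') = (s <= s').
Proof.
move=> [_ kP actS] le_s lt; have [kn ak] := kP s' lt.
have dec d s0 : s0 + d <= n -> act (s0 + d) (k s') -> act s0 (k s').
  elim: d => [|d IH]; rewrite ?addn0 // addnS => le.
  by rewrite actS // => /andP[/(IH (ltnW le))].
case: leqP => [le|gt]; first by apply: (dec (s' - s)); rewrite subnKC // ltnW.
apply/negP => a; have : act s'.+1 (k s').
  by apply: (dec (s - s'.+1)); rewrite subnKC.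
by rewrite actS // eqxx andbF.
Qed.

Lemma removal_onto n act k q : removal n act k -> q < n -> exists2 s, s < n & k s = q.
Proof.
move=> rem lt; have [act0 _ actS] := rem; have := removal_last rem lt.
suff : forall m, m <= n -> act m q \/ exists2 s, s < n & k s = q.
  by move/(_ n (leqnn n)) => [->|].
elim=> [|m IH] lem; first by left; apply: act0.
case: (IH (ltnW lem)) => [am|]; last by right.
rewrite actS // am; case: eqP => [->|]; last by left.
by right; exists m.
Qed.

(** Multiplied by [l = L (v s) (k s)], the weights of round [s] split into those of round [s.+1] and
    the multiple [W s (k s)] of the loads on [v s], a dual variable. The claim is linear in the
    weights: the first part is the induction hypothesis, the second follows from the parallel
    inequality on [v s]. *)
Lemma order_bound n (L : nat -> nat -> nat) (act : nat -> nat -> bool)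
    (W : nat -> nat -> nat) (v k : nat -> nat) (C M : nat -> nat) :
    removal n act k ->
    (forall s u, s < n ->
       \sum_(q < n | act s q) L u q <= \sum_(q < n | act s q) L (v s) q) ->
    (forall s q, s < n -> q < n -> act s q ->
       W s (k s) * L (v s) q <= W s q * L (v s) (k s)) ->
    (forall s q, s < n -> q < n -> act s q ->
       L (v s) (k s) = 0 -> L (v s) q = 0) ->
    (forall s q, s < n -> q < n -> act s q ->
       W s.+1 q = W s q * L (v s) (k s) - W s (k s) * L (v s) q) ->
    (forall s, s < n -> M (k s) = \sum_(q < n | act s q) L (v s) q) ->
    capacity n L C ->
  n.+1 * \sum_(q < n) W 0 q * M q <= 2 * n * \sum_(q < n) W 0 q * C q.
Proof.
move=> rem vmax ratio zero WS MP cap.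
have [act0 kP actS] := rem.
have act_n q := removal_last (q := q) rem.
set T := fun s => \sum_(q < n | act s q) L (v s) q.
(* Bottleneck loads do not increase from round to round: the next bottleneck carries no more with
   fewer jobs, and in the current round it was beaten by [v s]. *)
have Mle m : forall s q, n - s <= m -> s <= n -> q < n -> act s q -> M q <= T s.
  elim: m => [|m IH] s q le_m le_s ltq.
    by rewrite (_ : s = n) ?act_n //; lia.
  case: (ltnP s n) => [lt aq|ge]; last by rewrite (_ : s = n) ?act_n //; lia.
  case: (q =P k s) => [->|/eqP neq]; first by rewrite MP.
  have aq' : act s.+1 q by rewrite actS // aq.
  apply: leq_trans (IH s.+1 q _ lt ltq aq') _; first by lia.
  apply: leq_trans (vmax s (v s.+1) lt).
  rewrite [leqRHS]big_mkcond [leqLHS]big_mkcond /=; apply: leq_sum => i _.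
  by rewrite actS //; case: (act s i) => //=; case: ifP.
suff main m : forall s, n - s <= m -> s <= n ->
    n.+1 * \sum_(q < n | act s q) W s q * M q
      <= 2 * n * \sum_(q < n | act s q) W s q * C q.
  have := main n 0; rewrite subn0 leqnn leq0n => /(_ isT isT).
  have all0 F : \sum_(q < n | act 0 q) F q = \sum_(q < n) F q.
    by apply: eq_bigl => q; rewrite act0.
  by rewrite !all0.
elim: m => [|m IH] s le_m le_s.
  rewrite big_pred0 ?muln0 // => q.
  by rewrite (_ : s = n) ?act_n //; lia.
case: (ltnP s n) => [lt|ge]; last first.
  rewrite big_pred0 ?muln0 // => q.
  by rewrite (_ : s = n) ?act_n //; lia.
have [kn ak] := kP s lt.
(* A factor [l = 0] would erase the weights. But then all active loads on the bottleneck vanish, so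
   [T s = 0] and every remaining [M q] is 0. *)
case: (posnP (L (v s) (k s))) => [l0|l_gt0].
  rewrite big1 ?muln0 // => q aq.
  have : M q <= T s by apply: (Mle (n - s)).
  rewrite /T big1; first by rewrite leqn0 => /eqP->; rewrite muln0.
  by move=> q' aq'; apply: zero.
set l := L (v s) (k s) in l_gt0 *.
have split_sum (F : nat -> nat) :
    l * (\sum_(q < n | act s q) W s q * F q) =
    \sum_(q < n | act s.+1 q) W s.+1 q * F q
    + W s (k s) * \sum_(q < n | act s q) L (v s) q * F q.
  have -> : \sum_(q < n | act s.+1 q) W s.+1 q * F q
          = \sum_(q < n | act s q) W s.+1 q * F q.
    rewrite [RHS](bigD1 (Ordinal kn)) //= WS // subnn mul0n add0n.
    by apply: eq_bigl => q; rewrite actS.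
  rewrite !big_distrr -big_split /=; apply: eq_bigr => q aq.
  (* The truncated subtraction in [WS] is exact because [k s] minimises the ratio. *)
  rewrite WS // !mulnA -mulnDl subnK ?(mulnC l) //.
  exact: ratio.
rewrite -(leq_pmul2l l_gt0) ![l * (_ * _)]mulnCA !split_sum !mulnDr.
apply: leq_add; first by apply: IH => //; lia.
rewrite ![_ * (W s (k s) * _)]mulnCA leq_mul2l; apply/orP; right.
have := weighted_completion_lower (v s) (fun q : 'I_n => act s q) cap.
have := sqr_sum_leq (fun q : 'I_n => act s q) (fun q => L (v s) q).
have : \sum_(q < n | act s q) L (v s) q * M q <= T s ^ 2.
  rewrite expnS expn1 {2}/T big_distrr /=; apply: leq_sum => q aq.
  by rewrite mulnC leq_mul2r (Mle (n - s)) ?orbT.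
rewrite -/(T s); set S2 := \sum_(_ < n | _) _ ^ 2.
set SM := \sum_(_ < n | _) _ * _; set SC := \sum_(_ < n | _) _ * _.
move=> leM le2 leC.
have : n * (S2 + T s ^ 2) <= n * (2 * SC) by rewrite leq_mul2l leC orbT.
have : n.+1 * SM <= n.+1 * T s ^ 2 by rewrite leq_mul2l leM orbT.
by rewrite mulnDr mulSn; lia.
Qed.

(** * The program computing the order *)

Definition current_node := At aNode (var vK) (var vJ) (var vP).

Definition total_load :=
  put0 vTot (Lit 0) ;;
  SFor vQ (var vN) (SIf (at1 aAct (var vQ))
    (put0 vTot (var vTot [+] at2 aLoad current_node (var vQ))) skip).

Definition for_nodes p :=
  SFor vK (var vN) (SFor vJ (at1 aNf (var vK)) (SFor vP (at2 aLen (var vK) (var vJ)) p)).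

Definition find_bottleneck :=
  put0 vBest (Lit 0) ;; put0 vBv (Lit 0) ;;
  for_nodes (
    total_load ;;
    SIf (var vTot [-] var vBest) (put0 vBest (var vTot) ;; put0 vBv current_node) skip).

(* Minimises [W q / L q] over the active jobs; a job [q] with [L q = 0] is only
   kept as long as no other one is known. *)
Definition pick_next :=
  put0 vPick (var vN) ;;
  SFor vQ (var vN) (SIf (at1 aAct (var vQ))
    (SIf (at2 aLoad (var vBv) (var vPick))
      (SIf (at1 aW (var vPick) [*] at2 aLoad (var vBv) (var vQ)
            [-] at1 aW (var vQ) [*] at2 aLoad (var vBv) (var vPick))
        (put0 vPick (var vQ)) skip)
      (put0 vPick (var vQ))) skip).

(** The factor and the weight of the pick are saved first because the loop overwrites that weight
    too. Weights may be long, so they stand on the left of the products and the loads, which are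
    short, on the right. *)
Definition reweight :=
  put0 vFac (at2 aLoad (var vBv) (var vPick)) ;;
  put0 vWt (at1 aW (var vPick)) ;;
  SFor vQ (var vN) (put1 aW (var vQ)
    (at1 aW (var vQ) [*] var vFac [-] var vWt [*] at2 aLoad (var vBv) (var vQ))).

Definition record_pick :=
  put1 aAct (var vPick) (Lit 0) ;;
  put1 aOrd (var vN [-] Lit 1 [-] var vS) (var vPick) ;;
  put1 aPos (var vPick) (var vN [-] Lit 1 [-] var vS).

Definition loaded I (s : hstate) :=
  forall v k, s aLoad v k 0 = if k < ncoflows I then load I v k else 0.

Definition active (s : hstate) q := 0 < s aAct q 0 0.

Definition active_load I (s : hstate) v :=
  \sum_(q < ncoflows I | active s q) load I v q.

Lemma total_loadP N I (s : hstate) k j p v : fits N I -> s vN 0 0 0 = ncoflows I -> loaded I s ->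
    s vK 0 0 0 = k -> s vJ 0 0 0 = j -> s vP 0 0 0 = p -> s aNode k j p = v ->
  wp N total_load s (fun s' => s' vTot 0 0 0 = active_load I s v).
Proof.
move=> fi en ld ek ej ep ev; apply/wp_seq/wp_set => //.
apply: (@wp_for _ _ _ _ _ (ncoflows I) (fun i s' =>
   s' vTot 0 0 0 = \sum_(q < i | active s q) load I v q)) => //.
- exact: fits_ncoflows fi.
- by rewrite big_ord0.
move=> q s' ltq [fr _ _] IH; rewrite big_mkcond big_ord_recr -big_mkcond /=.
have fa : s' aAct q 0 0 = s aAct q 0 0 by rewrite fr.
apply: wp_if => /= act; apply: wp_set => //=; rewrite IH /active -fa.
  by rewrite act !fr //= ek ej ep ev ld ltq.
by rewrite act addn0.
Qed.

Lemma active_load_eq I (s s' : hstate) v : (forall q, s' aAct q 0 0 = s aAct q 0 0) ->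
  active_load I s' v = active_load I s v.
Proof. by move=> eq; apply: eq_bigl => q; rewrite /active eq. Qed.

Lemma loaded_eq I (s s' : hstate) : (forall v k, s' aLoad v k 0 = s aLoad v k 0) ->
  loaded I s -> loaded I s'.
Proof. by move=> eq ld v k; rewrite eq. Qed.

Lemma find_bottleneckP N I (s : hstate) : fits N I -> instance_read I s -> loaded I s ->
  wp N find_bottleneck s (fun s' => forall u,
    active_load I s u <= active_load I s (s' vBv 0 0 0)).
Proof.
move=> fi rd ld; have nN := fits_ncoflows fi; have [en _ _] := rd.
set al := active_load I s.
apply/wp_seq/wp_set => //; apply/wp_seq/wp_set => //.
(* Only an inequality links [vBest] to the load of [vBv]: at the start [vBest] is 0 while node 0 may
   carry load. *)
apply: (@wp_for _ _ _ _ _ (ncoflows I) (fun k s' =>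
  s' vBest 0 0 0 <= al (s' vBv 0 0 0) /\
  forall k' j v, is_flow I k' j -> k' < k -> v \in nodes (flow_at I k' j) ->
    al v <= s' vBest 0 0 0)) => //.
  move=> k s1 ltk pr1 [best IH]; have rd1 := instance_read_preserved pr1 rd isT.
  apply: (@wp_for _ _ _ _ _ (nflows I k) (fun j s' =>
    s' vBest 0 0 0 <= al (s' vBv 0 0 0) /\
    forall k' j' v, is_flow I k' j' -> k' < k \/ k' = k /\ j' < j ->
      v \in nodes (flow_at I k' j') -> al v <= s' vBest 0 0 0)).
  - by rewrite /= (instance_read_nf rd1).
  - exact: (fits_nflows fi ltk).
  - by split=> //= k' j' v fl [lt|[]//]; apply: IH.
  - move=> j s2 ltj pr2 [best2 IH2].
    have fl : is_flow I k j by rewrite /is_flow ltk ltj.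
    have rd2 := instance_read_preserved pr2 rd1 isT.
    have [_ elen enode] := instance_read_flow rd2 fl.
    have fk : s2 vK 0 0 0 = k by have [fr _ _] := pr2; rewrite fr.
    move: elen enode (fits_nodes fi fl).
    move: {-1}(nodes (flow_at I k j)) (erefl (nodes (flow_at I k j))) => nd end_ elen enode le_nd.
    apply: (@wp_for _ _ _ _ _ (size nd) (fun p s' =>
      s' vBest 0 0 0 <= al (s' vBv 0 0 0) /\
      forall k' j' v, is_flow I k' j' -> k' < k \/ k' = k /\ j' < j
          \/ k' = k /\ j' = j /\ v \in take p nd ->
        v \in nodes (flow_at I k' j') -> al v <= s' vBest 0 0 0)).
    + by rewrite /= fk elen.
    + by [].
    + split=> //= k' j' v fl' [lt|[lt|[_ [_]]]]; last by rewrite take0.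
        by apply: IH2 => //; left.
      by apply: IH2 => //; right.
    + move=> p s3 ltp [fr3 _ _] [best3 IH3]; apply: wp_seq.
      have [fr1 _ _] := pr1; have [fr2 _ _] := pr2.
      have alE u : active_load I (set_at s3 vP 0 0 0 p) u = al u.
        by apply: active_load_eq => q /=; rewrite fr3 //= fr2 //= fr1.
      apply: wp_conseq.
        apply: (@total_loadP N I _ k j p (nth 0 nd p)) => //=.
        * by rewrite fr3 //= fr2 //= fr1.
        * by apply: loaded_eq ld => v k' /=; rewrite fr3 //= fr2 //= fr1.
        * by rewrite fr3.
        * by rewrite fr3.
        * by rewrite fr3 //= enode.
      move=> s4 [fr4 _ _]; rewrite alE => tot.
      have node4 : heval s4 current_node = nth 0 nd p.
        by rewrite /= !fr4 //= !fr3 //= fk enode.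
      have best4 : s4 vBest 0 0 0 = s3 vBest 0 0 0 by rewrite fr4.
      have bv4 : s4 vBv 0 0 0 = s3 vBv 0 0 0 by rewrite fr4.
      have done v : v \in take p.+1 nd -> v \in take p nd \/ v = nth 0 nd p.
        by rewrite (take_nth 0) // mem_rcons inE => /orP[/eqP->|]; [right|left].
      apply: wp_if; rewrite -[heval _ _]/(s4 vTot 0 0 0 - s4 vBest 0 0 0) tot best4 => cmp.
        apply/wp_seq/wp_set => //; apply: wp_set => //.
        split; first by move: node4 => /= ->; rewrite tot.
        move=> k' j' v fl' case_v vin /=; rewrite tot.
        have imp : al v <= s3 vBest 0 0 0 -> al v <= al (nth 0 nd p) by lia.
        case: case_v => [lt|[lt|[ek [ej /done[vt|->//]]]]]; apply/imp/(IH3 k' j') => //.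
        * by left.
        * by right; left.
        * by right; right.
      apply: wp_set => //=; rewrite best4 bv4; split=> // k' j' v fl' case_v vin.
      case: case_v => [lt|[lt|[ek [ej /done[vt|->]]]]]; last by lia.
      * by apply: (IH3 k' j') => //; left.
      * by apply: (IH3 k' j') => //; right; left.
      * by apply: (IH3 k' j') => //; right; right.
    move=> s3 _ [best3 IH3]; split=> // k' j' v fl' case_v vin.
    apply: (IH3 k' j') => //; case: case_v => [lt|[ek lt]]; first by left.
    rewrite ltnS leq_eqVlt in lt; case/orP: lt => [/eqP ej|lt]; last by right; left.
    by right; right; rewrite take_size -end_; move: vin; rewrite ek ej.
  move=> s2 _ [best2 IH2]; split=> // k' j v fl; rewrite ltnS leq_eqVlt => /orP[/eqP ek|lt] vin.
    by apply: (IH2 k' j) => //; right; split=> //; move: fl; rewrite ek => /andP[].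
  by apply: (IH2 k' j) => //; left.
move=> s1 _ [best IH] u.
(* The search visits nodes of paths only; any other node has load 0. *)
have [[k [j [fl uin]]]|none] : (exists k j, is_flow I k j /\ u \in nodes (flow_at I k j))
    \/ (forall k j, is_flow I k j -> u \notin nodes (flow_at I k j)).
  case: (boolP [exists k : 'I_(ncoflows I), exists j : 'I_(nflows I k),
    u \in nodes (flow_at I k j)]) => [/existsP[k /existsP[j uin]]|no].
    by left; exists k, j; rewrite /is_flow !ltn_ord.
  right=> k j /andP[ltk ltj]; apply: contra no => uin.
  by apply/existsP; exists (Ordinal ltk); apply/existsP; exists (Ordinal ltj).
- by apply: leq_trans best; apply: (IH k j) => //; have /andP[] := fl.
rewrite /al /active_load big1 // => q _; rewrite /load big1 // => j _.
by rewrite (negbTE (none _ _ _)) // /is_flow !ltn_ord.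
Qed.

(** The ratios [W / L] compared by cross multiplication. If [W k = L k = 0], the inequality would
    hold even against a job of positive load; the second conjunct excludes such a pick. *)
Definition best_ratio (W L : nat -> nat) k q :=
  W k * L q <= W q * L k /\ (L k = 0 -> L q = 0).

Lemma best_ratio_trans (W L : nat -> nat) p k q :
  0 < L p -> W k * L p < W p * L k -> best_ratio W L p q -> best_ratio W L k q.
Proof.
move=> Lp lt [le _]; split=> [|Lk]; last by move: lt; rewrite Lk muln0.
rewrite -(leq_pmul2l Lp).
have : W k * L p * L q <= W p * L k * L q by rewrite leq_mul2r ltnW ?orbT.
have : L k * (W p * L q) <= L k * (W q * L p) by rewrite leq_mul2l le orbT.
by nia.
Qed.

Lemma pick_nextP N I (s : hstate) v : fits N I -> s vN 0 0 0 = ncoflows I -> loaded I s ->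
    s vBv 0 0 0 = v -> (exists2 q, q < ncoflows I & active s q) ->
  wp N pick_next s (fun s' => [/\ s' vPick 0 0 0 < ncoflows I, active s (s' vPick 0 0 0)
    & forall q, q < ncoflows I -> active s q ->
      best_ratio (fun q => s aW q 0 0) (load I v) (s' vPick 0 0 0) q]).
Proof.
move=> fi en ld ev [q0 ltq0 aq0]; apply/wp_seq/wp_set => //.
set W := fun q => s aW q 0 0; set n := ncoflows I in en ltq0 *.
(* [vPick] starts at the index [n] of no job. Its load reads 0, so the first active job replaces
   it. *)
have load0 : s aLoad v n 0 = 0 by rewrite ld ltnn.
apply: (@wp_for _ _ _ _ _ n (fun i s' =>
  (s' vPick 0 0 0 = n /\ forall q, q < i -> ~~ active s q) \/
  [/\ s' vPick 0 0 0 < n, active s (s' vPick 0 0 0)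
    & forall q, q < i -> active s q -> best_ratio W (load I v) (s' vPick 0 0 0) q])) => //.
- exact: fits_ncoflows fi.
- by left; rewrite /= en.
- move=> q s' ltq [fr _ _] IH.
  have ld' : loaded I s' by apply: loaded_eq ld => v' k; rewrite fr.
  have fa : s' aAct q 0 0 = s aAct q 0 0 by rewrite fr.
  have fv : s' vBv 0 0 0 = v by rewrite fr.
  have fW k : s' aW k 0 0 = W k by rewrite fr.
  apply: wp_if => /=; rewrite fa => act; last first.
    apply: wp_set => //=; case: IH => [[ep no]|[lt ap best]]; [left|right].
      split=> // q'; rewrite ltnS leq_eqVlt => /orP[/eqP->|]; last exact: no.
      by rewrite /active act.
    split=> // q'; rewrite ltnS leq_eqVlt => /orP[/eqP->|]; last exact: best.
    by rewrite /active act.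
  apply: wp_if => /=; rewrite fv => Lp; last first.
    apply: wp_set => //=; right; split=> // q'; rewrite ltnS leq_eqVlt => /orP[/eqP-> //|lt aq'].
    case: IH => [[_ /(_ _ lt)]|[ltp ap /(_ _ lt aq')[_ z]]]; first by rewrite aq'.
    (* The pick being replaced has load 0, so all active jobs seen before have load 0, and any new
       pick is best among them. *)
    have Lq' : load I v q' = 0 by apply: z; move: Lp; rewrite ld' ltp.
    by rewrite /best_ratio Lq' muln0.
  case: IH => [[ep _]|[ltp ap best]]; first by move: Lp; rewrite ep ld' ltnn.
  move: Lp; rewrite ld' ltp => Lp.
  apply: wp_if => /=; rewrite fv !fW !ld' ltq ltp => cmp; apply: wp_set => //=; right.
    split=> // q'; rewrite ltnS leq_eqVlt => /orP[/eqP-> //|lt aq'].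
    by apply: (best_ratio_trans Lp) (best _ lt aq'); rewrite -subn_gt0.
  split=> // q'; rewrite ltnS leq_eqVlt => /orP[/eqP-> _|]; last exact: best.
  split; last by move=> z; rewrite z in Lp.
  by move: cmp => /eqP; rewrite subn_eq0.
move=> s' _ [[_ /(_ _ ltq0)]|[ltp ap best]]; first by rewrite aq0.
by split.
Qed.

Lemma reweightP N I (s : hstate) v k : fits N I -> s vN 0 0 0 = ncoflows I -> loaded I s ->
    s vBv 0 0 0 = v -> s vPick 0 0 0 = k -> k < ncoflows I ->
  wp N reweight s (fun s' => forall q, q < ncoflows I ->
    s' aW q 0 0 = s aW q 0 0 * load I v k - s aW k 0 0 * load I v q).
Proof.
move=> fi en ld ev ek ltk; apply/wp_seq/wp_set => //; apply/wp_seq/wp_set => //=.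
rewrite ev ek ld ltk.
apply: (@wp_for _ _ _ _ _ (ncoflows I) (fun i s' => forall q,
   s' aW q 0 0 = if q < i then s aW q 0 0 * load I v k - s aW k 0 0 * load I v q
                 else s aW q 0 0)) => //.
- exact: fits_ncoflows fi.
- move=> i s' lti [fr _ _] IH.
  have ef : s' vFac 0 0 0 = load I v k by rewrite fr.
  have ew : s' vWt 0 0 0 = s aW k 0 0 by rewrite fr.
  have el : s' aLoad (s' vBv 0 0 0) i 0 = load I v i by rewrite !fr //= ev ld lti.
  apply: wp_set => /=; rewrite ef el; first by rewrite !(fits_load fi).
  move=> q; rewrite ew eqxx andbT ltnS [q <= i]leq_eqVlt; case: eqP => [->|_] /=.
    by rewrite IH ltnn.
  by rewrite IH.
by move=> s' _ IH q ltq; rewrite IH ltq.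
Qed.

Definition round I i (s s' : hstate) :=
  let n := ncoflows I in let k := s' vPick 0 0 0 in let v := s' vBv 0 0 0 in
  [/\ k < n /\ active s k,
      forall u, active_load I s u <= active_load I s v,
      forall q, q < n -> active s q -> best_ratio (fun q => s aW q 0 0) (load I v) k q,
      forall q, q < n -> s' aW q 0 0 = s aW q 0 0 * load I v k - s aW k 0 0 * load I v q
    & [/\ forall q, active s' q = active s q && (q != k),
          forall j, s' aOrd j 0 0 = if j == n - i.+1 then k else s aOrd j 0 0
        & forall q, s' aPos q 0 0 = if q == k then n - i.+1 else s aPos q 0 0]].

Definition order_round := find_bottleneck ;; pick_next ;; reweight ;; record_pick.

Lemma order_roundP N I (s : hstate) i : fits N I -> instance_read I s -> loaded I s ->
    s vS 0 0 0 = i -> (exists2 q, q < ncoflows I & active s q) ->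
  wp N order_round s (round I i s).
Proof.
move=> fi rd ld ei exq; have [en _ _] := rd.
apply/wp_seq/(wp_conseq (find_bottleneckP fi rd ld)) => s1 [fr1 _ _] vmax.
have ld1 : loaded I s1 by apply: loaded_eq ld => v q; rewrite fr1.
have act1 q : active s1 q = active s q by rewrite /active fr1.
have en1 : s1 vN 0 0 0 = ncoflows I by rewrite fr1.
apply/wp_seq/(wp_conseq (pick_nextP fi en1 ld1 (erefl _) _)).
  by case: exq => q ltq aq; exists q; rewrite ?act1.
move=> s2 [fr2 _ _] [ltk ak best].
have ld2 : loaded I s2 by apply: loaded_eq ld1 => v q; rewrite fr2.
have en2 : s2 vN 0 0 0 = ncoflows I by rewrite fr2.
apply/wp_seq/(wp_conseq (reweightP fi en2 ld2 (erefl _) (erefl _) ltk)).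
move=> s3 [fr3 _ _] eW; apply/wp_seq/wp_set => //; apply/wp_seq/wp_set => //; apply: wp_set => //.
have ek : s3 vPick 0 0 0 = s2 vPick 0 0 0 by rewrite fr3.
have ev : s3 vBv 0 0 0 = s1 vBv 0 0 0 by rewrite fr3 // fr2.
have en3 : s3 vN 0 0 0 = ncoflows I by rewrite fr3.
have ei3 : s3 vS 0 0 0 = i by rewrite fr3 // fr2 // fr1.
have fW2 q : s2 aW q 0 0 = s aW q 0 0 by rewrite fr2 // fr1.
have ev2 : s2 vBv 0 0 0 = s1 vBv 0 0 0 by rewrite fr2.
have fW q : s1 aW q 0 0 = s aW q 0 0 by rewrite fr1.
have subE : ncoflows I - 1 - i = ncoflows I - i.+1 by rewrite -subnDA add1n.
rewrite /round /= ek ev en3 ei3 subE; split.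
- by rewrite -act1.
- exact: vmax.
- by move=> q ltq aq; have := best q ltq; rewrite act1 /best_ratio !fW; apply.
- by move=> q ltq; rewrite eW // !fW2 ev2.
split.
- move=> q; rewrite /active /= !andbT; case: eqP => [->|_]; first by rewrite andbF.
  by rewrite andbT fr3 // fr2 // fr1.
- by move=> j; rewrite ?eqxx ?andbT (fr3 aOrd) // (fr2 aOrd) // (fr1 aOrd).
by move=> q; rewrite ?eqxx ?andbT (fr3 aPos) // (fr2 aPos) // (fr1 aPos).
Qed.

Definition prefix_load I (pos : nat -> nat) k v :=
  \sum_(q < ncoflows I | pos q <= pos k) load I v q.

(** The interface between the order and the schedule. [M] is the bottleneck load in the round that
    places the coflow; [C] is arbitrary, so that the completion times of an optimal schedule can be
    inserted. *)
Definition good_priority I (ord pos : nat -> nat) :=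
  let n := ncoflows I in
  [/\ forall i, i < n -> ord i < n /\ pos (ord i) = i,
      forall q, q < n -> pos q < n /\ ord (pos q) = q
    & exists M : nat -> nat,
       (forall q v, q < n -> prefix_load I pos q v <= M q) /\
       forall C, capacity n (load I) C ->
         n.+1 * \sum_(q < n) int_weight I q * M q
           <= 2 * n * \sum_(q < n) int_weight I q * C q].

Definition order_jobs := SFor vS (var vN) order_round.

Lemma order_jobsP N I (s : hstate) : fits N I -> instance_read I s -> loaded I s ->
    (forall k, k < ncoflows I -> s aW k 0 0 = int_weight I k /\ s aAct k 0 0 = 1) ->
  wp N order_jobs s (fun s' =>
    good_priority I (fun i => s' aOrd i 0 0) (fun q => s' aPos q 0 0)).
Proof.
move=> fi rd ld init; set n := ncoflows I in init *; have [en _ _] := rd.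
apply: (@wp_for_hist _ _ _ _ _ n
  (fun i s' => \sum_(q < n | active s' q) 1 = n - i) (round I)) => //.
- exact: fits_ncoflows fi.
- rewrite subn0 -[RHS]card_ord -sum1_card; apply: eq_bigl => q.
  by rewrite /active; have [_ ->] := init q (ltn_ord q).
- move=> i s' lti pr Ji; have [fr _ _] := pr.
  have rd' := instance_read_preserved pr rd isT.
  have ld' : loaded I s' by apply: loaded_eq ld => v q; rewrite fr.
  apply: wp_conseq.
    apply: (@order_roundP N I _ i) => //.
    case: (pickP (fun q : 'I_n => active s' q)) => [q aq|none]; first by exists q.
    by move: Ji; rewrite big_pred0 //; lia.
  move=> s'' _ rnd; split=> //; case: rnd => -[ltk ak] _ _ _ [actE _ _].
  move: Ji; rewrite (bigD1 (Ordinal ltk)) //= => Ji.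
  rewrite (eq_bigl (fun q : 'I_n => active s' q && (q != Ordinal ltk))).
    by rewrite subnS -Ji add1n.
  by move=> q; rewrite actE.
move=> st st0 _ stR.
pose act i q := active (st i) q.
pose k i := st i.+1 vPick 0 0 0.
pose v i := st i.+1 vBv 0 0 0.
have rem : removal n act k.
  split; first by move=> q ltq; rewrite /act st0 /active; have [_ ->] := init q ltq.
    by move=> i lti; case: (stR i lti).
  by move=> i q lti _; case: (stR i lti) => _ _ _ _ [actE _ _]; apply: actE.
have kn i : i < n -> k i < n by case: rem => _ kP _ /kP[].
(* Different rounds pick different jobs, so an entry of [aPos] survives once written. *)
have posP i : i < n -> st n aPos (k i) 0 0 = n - i.+1.
  move=> lti; suff : forall m, i < m -> m <= n -> st m aPos (k i) 0 0 = n - i.+1.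
    by apply.
  elim=> // m IH; rewrite ltnS leq_eqVlt => /orP[/eqP<- le|lt le].
    by case: (stR i le) => _ _ _ _ [_ _ ->]; rewrite eqxx.
  case: (stR m le) => _ _ _ _ [_ _ ->]; case: eqP => [eq|_]; last by rewrite IH // ltnW.
  have := removal_act rem (ltnW le) lti; rewrite [k i]eq -/(k m) (removal_act rem (ltnW le) le).
  by rewrite leqnn leqNgt lt.
have ordP i : i < n -> st n aOrd (n - i.+1) 0 0 = k i.
  move=> lti; suff : forall m, i < m -> m <= n -> st m aOrd (n - i.+1) 0 0 = k i.
    by apply.
  elim=> // m IH; rewrite ltnS leq_eqVlt => /orP[/eqP<- le|lt le].
    by case: (stR i le) => _ _ _ _ [_ -> _]; rewrite eqxx.
  case: (stR m le) => _ _ _ _ [_ -> _]; case: eqP => [eq|_]; last by rewrite IH // ltnW.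
  by move: eq lt le; lia.
have onto q : q < n -> exists2 i, i < n & k i = q by apply: removal_onto rem.
(* Positions are filled from the end, so the jobs active in round [i] are exactly those placed not
   after [k i]. Hence prefix loads are active loads. *)
have actP i q : i < n -> q < n -> (st n aPos q 0 0 <= st n aPos (k i) 0 0) = act i q.
  move=> lti /onto[j ltj <-]; rewrite !posP // (removal_act rem) //; last exact: ltnW.
  by apply/idP/idP; lia.
split.
- move=> i lti; have lt : n - i.+1 < n by lia.
  have eq : n - (n - i.+1).+1 = i by lia.
  by have := ordP _ lt; rewrite eq => ->; rewrite posP // kn.
- move=> q /onto[i lti <-]; rewrite posP // ordP //; split=> //; lia.
pose T i := \sum_(q < n | act i q) load I (v i) q.
have TE i : i < n -> T (n - (st n aPos (k i) 0 0).+1) = T i.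
  by move=> lti; rewrite posP // (_ : n - _.+1 = i) //; lia.
(* A job at position [p] was placed in round [n - p.+1]. *)
exists (fun q => T (n - (st n aPos q 0 0).+1)); split.
  move=> q u /onto[i lti <-]; rewrite TE // /prefix_load.
  case: (stR i lti) => _ /(_ u) le _ _ _; apply: leq_trans le.
  by rewrite /active_load leq_eqVlt; apply/orP; left; apply/eqP/eq_bigl => q'; rewrite actP.
move=> C cap.
have WE q : q < n -> int_weight I q = st 0 aW q 0 0 by rewrite st0 => /init[].
rewrite (eq_bigr (fun q : 'I_n => st 0 aW q 0 0 * T (n - (st n aPos q 0 0).+1))); last first.
  by move=> q _; rewrite WE.
rewrite [X in _ <= _ * X](eq_bigr (fun q : 'I_n => st 0 aW q 0 0 * C q)); last first.
  by move=> q _; rewrite WE.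
apply: (@order_bound n (load I) act (fun i q => st i aW q 0 0) v k C
  (fun q => T (n - (st n aPos q 0 0).+1))) => //.
- by move=> i u lti; case: (stR i lti) => _ /(_ u).
- by move=> i q lti ltq aq; case: (stR i lti) => _ _ /(_ q ltq aq)[].
- by move=> i q lti ltq aq; case: (stR i lti) => _ _ /(_ q ltq aq)[].
- by move=> i q lti ltq aq; case: (stR i lti) => _ _ _ ->.
Qed.

(** * The greedy schedule *)

Definition dem I k j := demand (flow_at I k j).
Definition rls I k := release (coflow_at I k).
Definition path_nodes I k j := nodes (flow_at I k j).

(* At time [t], with [dn k j] units of flow [j] of coflow [k] already sent, the
   flows [D] have been considered and those in [ch] among them are to be sent
   during the next [dl] steps; [dl = 0] means that no bound on [dl] is known. *)
Record selection I (pos : nat -> nat) (dn : nat -> nat -> nat) t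
    (D ch : nat -> nat -> bool) dl : Prop := Selection {
  sel_wait : forall k j, is_flow I k j -> D k j -> dn k j < dem I k j -> t < rls I k ->
    0 < dl <= rls I k - t;
  sel_chosen : forall k j, is_flow I k j -> ch k j ->
    [/\ D k j, rls I k <= t, 0 < dl & dl <= dem I k j - dn k j];
  sel_blocked : forall k j, is_flow I k j -> D k j -> dn k j < dem I k j ->
    rls I k <= t -> ~~ ch k j ->
    exists k' j' v, [/\ is_flow I k' j', pos k' <= pos k, ch k' j',
      v \in path_nodes I k j & v \in path_nodes I k' j'];
  sel_disjoint : forall k j k' j' v, is_flow I k j -> is_flow I k' j' ->
    ch k j -> ch k' j' -> v \in path_nodes I k j -> v \in path_nodes I k' j' ->
    (k, j) = (k', j');
  sel_tight : dl = 0 \/ exists k j, [/\ is_flow I k j, dn k j < dem I k j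
    & (t < rls I k /\ dl = rls I k - t) \/ (ch k j /\ dl = dem I k j - dn k j)] }.

Definition gap_min dl g := if dl == 0 then g else minn dl g.

Lemma gap_minP dl g : 0 < g ->
  [/\ 0 < gap_min dl g, gap_min dl g <= g, 0 < dl -> gap_min dl g <= dl
    & gap_min dl g = g \/ gap_min dl g = dl /\ 0 < dl].
Proof.
move=> g0; rewrite /gap_min; case: eqP => [->|]; first by split=> //; left.
move/eqP; rewrite -lt0n => dl0; rewrite /minn; case: (ltnP dl g) => le; split=> //.
- exact: ltnW.
- by right.
- by left.
Qed.

Lemma selection_eq I pos dn t (D D' ch ch' : nat -> nat -> bool) dl :
    (forall k j, is_flow I k j -> D k j = D' k j) ->
    (forall k j, is_flow I k j -> ch k j = ch' k j) ->
  selection I pos dn t D ch dl -> selection I pos dn t D' ch' dl.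
Proof.
move=> eD ech [w c b d ti]; split.
- by move=> k j fl; rewrite -eD //; apply: w.
- by move=> k j fl; rewrite -eD // -ech //; apply: c.
- move=> k j fl; rewrite -eD // -ech // => Dk pd re nc.
  have [k' [j' [v [fl' le cj v1 v2]]]] := b k j fl Dk pd re nc.
  by exists k', j', v; split; rewrite -?ech.
- by move=> k j k' j' v fl fl'; rewrite -!ech //; apply: d.
case: ti => [|[k [j [fl pd h]]]]; [by left|right].
by exists k, j; split; rewrite -?ech.
Qed.

Definition add_flow (D : nat -> nat -> bool) k j k' j' := D k' j' || (k' == k) && (j' == j).

(** Covers a finished flow and a released flow blocked by a chosen one; neither restricts the length
    [dl]. *)
Lemma selection_skip I pos dn t D (ch : nat -> nat -> bool) dl k j :
    dem I k j <= dn k j \/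
    rls I k <= t /\ (exists k' j' v, [/\ is_flow I k' j', pos k' <= pos k, ch k' j',
      v \in path_nodes I k j & v \in path_nodes I k' j']) ->
  selection I pos dn t D ch dl -> selection I pos dn t (add_flow D k j) ch dl.
Proof.
move=> ex [w c b d ti]; split=> //.
- move=> k' j' fl /orP[Dk|/andP[/eqP-> /eqP->]]; first exact: w.
  by case: ex => [|[]]; lia.
- by move=> k' j' fl /(c _ _ fl)[Dk re dl0 le]; split=> //; rewrite /add_flow Dk.
move=> k' j' fl /orP[Dk|/andP[/eqP-> /eqP->]] pd re nc; first exact: b.
by case: ex => [|[_ //]]; rewrite leqNgt pd.
Qed.

Lemma selection_wait I pos dn t D (ch : nat -> nat -> bool) dl k j :
    is_flow I k j -> dn k j < dem I k j -> t < rls I k ->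
    selection I pos dn t D ch dl ->
  selection I pos dn t (add_flow D k j) ch (gap_min dl (rls I k - t)).
Proof.
move=> fl0 pd0 un0 [w c b d ti]; have g0 : 0 < rls I k - t by rewrite subn_gt0.
have [gt0 leg ledl gE] := gap_minP dl g0; split=> //.
- move=> k' j' fl /orP[Dk|/andP[/eqP-> /eqP->]] pd un; last by rewrite gt0.
  have /andP[dl0 le] := w _ _ fl Dk pd un.
  by rewrite gt0; apply: leq_trans le; apply: ledl.
- move=> k' j' fl /(c _ _ fl)[Dk re dl0 le]; split; rewrite /add_flow ?Dk //.
  by apply: leq_trans le; apply: ledl.
- move=> k' j' fl /orP[Dk|/andP[/eqP-> /eqP->]] pd re nc; first exact: b.
  by move: re; rewrite leqNgt un0.
right; case: gE => [->|[-> dl0]]; first by exists k, j; split=> //; left.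
by case: ti dl0 => [->|].
Qed.

Lemma selection_choose I pos dn t D (ch : nat -> nat -> bool) dl k j :
    is_flow I k j -> dn k j < dem I k j -> rls I k <= t ->
    (forall k' j' v, is_flow I k' j' -> ch k' j' -> v \in path_nodes I k j ->
       v \notin path_nodes I k' j') ->
    selection I pos dn t D ch dl ->
  selection I pos dn t (add_flow D k j) (add_flow ch k j) (gap_min dl (dem I k j - dn k j)).
Proof.
move=> fl0 pd0 re0 free [w c b d ti].
have g0 : 0 < dem I k j - dn k j by rewrite subn_gt0.
have [gt0 leg ledl gE] := gap_minP dl g0; split=> //.
- move=> k' j' fl /orP[Dk|/andP[/eqP-> /eqP->]] pd un; last by lia.
  have /andP[dl0 le] := w _ _ fl Dk pd un.
  by rewrite gt0; apply: leq_trans le; apply: ledl.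
- move=> k' j' fl /orP[/(c _ _ fl)[Dk re dl0 le]|/andP[/eqP-> /eqP->]].
    by split; rewrite /add_flow ?Dk //; apply: leq_trans le; apply: ledl.
  by split; rewrite /add_flow ?eqxx ?orbT.
- move=> k' j' fl; rewrite negb_or => /orP[Dk|->]; last by rewrite andbF.
  move=> pd re /andP[nc _]; have [k2 [j2 [v [fl2 le2 ch2 v1 v2]]]] := b _ _ fl Dk pd re nc.
  by exists k2, j2, v; split; rewrite /add_flow ?ch2.
- move=> k1 j1 k2 j2 v fl1 fl2 /orP[c1|/andP[/eqP-> /eqP->]] /orP[c2|/andP[/eqP-> /eqP->]] //.
  + exact: d.
  + by move=> v1 v2; have := free _ _ _ fl1 c1 v2; rewrite v1.
  + by move=> v1 v2; have := free _ _ _ fl2 c2 v1; rewrite v2.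
right; case: gE => [->|[-> dl0]].
  by exists k, j; split=> //; right; rewrite /add_flow !eqxx orbT.
case: ti dl0 => [->//|[k' [j' [fl pd h]]]] _; exists k', j'; split=> //.
by case: h => [|[c' e]]; [left|right; rewrite /add_flow c'].
Qed.

Definition all_flows (k j : nat) := true.

(** Event [e] covers the time steps [tm e + 1] to [tm e.+1]. Once all flows are finished,
    [sel_tight] forces [dl e = 0], so the number [T] of events can be fixed in advance. *)
Record greedy_trace I (pos : nat -> nat) T (tm : nat -> nat)
    (dn : nat -> nat -> nat -> nat) (ch : nat -> nat -> nat -> bool) (dl : nat -> nat) : Prop :=
  GreedyTrace {
    trace_tm0 : tm 0 = 0;
    trace_dn0 : forall k j, is_flow I k j -> dn 0 k j = 0;
    trace_sel : forall e, e < T -> selection I pos (dn e) (tm e) all_flows (ch e) (dl e);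
    trace_tm : forall e, e < T -> tm e.+1 = tm e + dl e;
    trace_dn : forall e k j, e < T -> is_flow I k j ->
      dn e.+1 k j = dn e k j + ch e k j * dl e }.

Lemma trace_dn_le I pos T tm dn ch dl e k j : greedy_trace I pos T tm dn ch dl ->
  is_flow I k j -> e <= T -> dn e k j <= dem I k j.
Proof.
move=> tr fl; elim: e => [|e IH] lt; first by rewrite (trace_dn0 tr).
rewrite (trace_dn tr) //; case c : (ch e k j); last by rewrite addn0 IH // ltnW.
have [_ _ _ le] := sel_chosen (trace_sel tr lt) fl c.
by rewrite mul1n; have := IH (ltnW lt); lia.
Qed.

Lemma trace_done I pos T tm dn ch dl k j : greedy_trace I pos T tm dn ch dl ->
    T = ncoflows I + \sum_(k < ncoflows I) nflows I k ->
  is_flow I k j -> dn T k j = dem I k j.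
Proof.
move=> tr eT fl.
(* A measure: unreleased coflows plus unfinished flows, at most [T] at the start. *)
pose mu e := \sum_(k < ncoflows I)
  ((tm e < rls I k) + \sum_(j < nflows I k) (dn e k j < dem I k j)).
pose pending e := exists k j, is_flow I k j /\ dn e k j < dem I k j.
have mu0 : mu 0 <= T.
  rewrite eT -[X in X + _]card_ord -sum1_card -big_split /=; apply: leq_sum => i _.
  apply: leq_add; first exact: leq_b1.
  rewrite -[leqRHS]card_ord -sum1_card; apply: leq_sum => i' _; exact: leq_b1.
have mono e k' : e < T -> (tm e.+1 < rls I k') <= (tm e < rls I k').
  move=> lt; rewrite (trace_tm tr) //.
  by case: (ltnP (tm e)) => //; case: (ltnP (tm e + _)) => //; lia.
have mono' e k' j' : e < T -> is_flow I k' j' ->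
    (dn e.+1 k' j' < dem I k' j') <= (dn e k' j' < dem I k' j').
  move=> lt fl'; rewrite (trace_dn tr) //.
  by case: (ltnP (dn e k' j')) => //; case: (ltnP (_ + _)) => //; lia.
have step e : e < T -> pending e -> mu e.+1 < mu e.
  move=> lt [k1 [j1 [fl1 pd1]]]; have sel := trace_sel tr lt.
  (* An unfinished flow waits for its release, is chosen, or is blocked by a chosen flow; each case
     makes [dl e] positive. *)
  have dl0 : 0 < dl e.
    case: (ltnP (tm e) (rls I k1)) => [un|re].
      by have /andP[] := sel_wait sel fl1 isT pd1 un.
    case: (boolP (ch e k1 j1)) => [c|nc]; first by have [] := sel_chosen sel fl1 c.
    have [k2 [j2 [v [fl2 _ c _ _]]]] := sel_blocked sel fl1 isT pd1 re nc.
    by have [] := sel_chosen sel fl2 c.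
  (* As [dl e] is not 0, it is attained by some release or some completion of a flow, and the
     corresponding term of [mu] drops to 0. *)
  case: (sel_tight sel) => [e0|[k2 [j2 [fl2 pd2 tight]]]]; first by rewrite e0 in dl0.
  have /andP[ltk ltj] := fl2.
  rewrite /mu (bigD1 (Ordinal ltk)) //= [X in _ < X](bigD1 (Ordinal ltk)) //= -addSn.
  apply: leq_add; last first.
    apply: leq_sum => i _; apply: leq_add; first exact: mono.
    by apply: leq_sum => i' _; apply: mono'; rewrite // /is_flow !ltn_ord.
  rewrite (bigD1 (Ordinal ltj)) //= [X in _ < _ + X](bigD1 (Ordinal ltj)) //=.
  have := mono e k2 lt; have := mono' e k2 j2 lt fl2.
  have : \sum_(i < nflows I k2 | i != Ordinal ltj) (dn e.+1 k2 i < dem I k2 i)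
      <= \sum_(i < nflows I k2 | i != Ordinal ltj) (dn e k2 i < dem I k2 i).
    by apply: leq_sum => i' _; apply: mono'; rewrite // /is_flow ltk ltn_ord.
  set A := \sum_(_ < _ | _) _; set B := \sum_(_ < _ | _) _.
  case: tight => [[un ed]|[c ed]].
    have -> : (tm e.+1 < rls I k2) = false by rewrite (trace_tm tr) // ed; lia.
    by rewrite un; lia.
  have -> : (dn e.+1 k2 j2 < dem I k2 j2) = false.
    by rewrite (trace_dn tr) // c ed; lia.
  by rewrite pd2; lia.
have dec e : e <= T -> ~ pending e \/ mu e + e <= T.
  elim: e => [|e IH] lt; first by right; rewrite addn0.
  have pmono : pending e.+1 -> pending e.
    move=> [k1 [j1 [fl1 pd1]]]; exists k1, j1; split=> //.
    by have := mono' e k1 j1 lt fl1; rewrite pd1; case: (_ < _).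
  case: (IH (ltnW lt)) => [np|le]; first by left=> /pmono.
  case: (boolP [exists k : 'I_(ncoflows I), exists j : 'I_(nflows I k),
    dn e k j < dem I k j]) => [/existsP[k1 /existsP[j1 pd]]|no].
    right; have : pending e by exists k1, j1; rewrite /is_flow !ltn_ord.
    by move/(step e lt); lia.
  left=> /pmono[k1 [j1 [/andP[ltk ltj] pd]]]; case/negP: no.
  by apply/existsP; exists (Ordinal ltk); apply/existsP; exists (Ordinal ltj).
apply/eqP; rewrite eqn_leq (trace_dn_le tr) //= leqNgt; apply/negP => pd.
case: (dec T (leqnn T)) => [np|le]; first by apply: np; exists k, j.
have /eqP : mu T = 0 by lia.
have /andP[ltk ltj] := fl.
rewrite /mu (bigD1 (Ordinal ltk)) //= (bigD1 (Ordinal ltj)) //= pd.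
by rewrite !addn_eq0 andbF.
Qed.

(** * From traces to feasible schedules *)

Definition trace_schedule I T tm (ch : nat -> nat -> nat -> bool) dl : compact_schedule :=
  mkseq (fun k => mkseq (fun j =>
    mkseq (fun e => (tm e + 1, ch e k j * dl e)) T) (nflows I k)) (ncoflows I).

Definition units (tm : nat -> nat) (ch : nat -> nat -> nat -> bool) dl k j e :=
  flatten [seq iota (tm e' + 1) (ch e' k j * dl e') | e' <- iota 0 e].

Lemma expand_trace I T tm ch dl k j : is_flow I k j ->
  expand (trace_schedule I T tm ch dl) k j = units tm ch dl k j T.
Proof.
by case/andP=> ltk ltj; rewrite /expand /trace_schedule !nth_mkseq // /units /mkseq -map_comp.
Qed.

Lemma unitsS tm ch dl k j e :
  units tm ch dl k j e.+1 = units tm ch dl k j e ++ iota (tm e + 1) (ch e k j * dl e).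
Proof. by rewrite /units -[e.+1]addn1 iotaD map_cat flatten_cat /= cats0. Qed.

Lemma trace_tm_mono I pos T tm dn ch dl e e' : greedy_trace I pos T tm dn ch dl ->
  e <= e' -> e' <= T -> tm e <= tm e'.
Proof.
move=> tr; elim: e' => [|e' IH]; first by rewrite leqn0 => /eqP->.
rewrite leq_eqVlt => /orP[/eqP->//|lt le]; rewrite (trace_tm tr) //.
by rewrite (leq_trans (IH lt (ltnW le))) ?leq_addr.
Qed.

Lemma mem_units I pos T tm dn ch dl k j e t : greedy_trace I pos T tm dn ch dl ->
    e <= T -> t \in units tm ch dl k j e ->
  exists e', [/\ e' < e, ch e' k j & tm e' < t <= tm e'.+1].
Proof.
move=> tr; elim: e => // e IH lt; rewrite unitsS mem_cat => /orP[/(IH (ltnW lt))|].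
  by case=> e' [lt' c b]; exists e'; split=> //; apply: leq_trans lt' _.
rewrite mem_iota => b; exists e; rewrite (trace_tm tr) //.
by case: (ch e k j) b => /= b; split=> //; lia.
Qed.

Lemma trace_feasible I pos T tm dn ch dl : greedy_trace I pos T tm dn ch dl ->
    (forall k j, is_flow I k j -> dn T k j = dem I k j) ->
  feasible I (expand (trace_schedule I T tm ch dl)).
Proof.
move=> tr fin; split.
  move=> k j fl; rewrite expand_trace //; split.
  - suff : forall e, e <= T -> uniq (units tm ch dl k j e) by apply.
    elim=> // e IH lt; rewrite unitsS cat_uniq IH ?(ltnW lt) // iota_uniq andbT /=.
    apply/hasPn => t; rewrite mem_iota => /andP[ge _]; apply/negP => /(mem_units tr (ltnW lt)).
    case=> e' [lt' _ /andP[_ le]].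
    by have := trace_tm_mono tr lt' (ltnW lt); lia.
  - rewrite -/(dem I k j) -fin //.
    suff : forall e, e <= T -> size (units tm ch dl k j e) = dn e k j by apply.
    elim=> [|e IH] lt; first by rewrite (trace_dn0 tr).
    by rewrite unitsS size_cat IH ?(ltnW lt) // size_iota (trace_dn tr).
  move=> t /(mem_units tr (leqnn T))[e [lt c /andP[gt _]]].
  have [_ re _ _] := sel_chosen (trace_sel tr lt) fl c.
  by rewrite addn1; apply: leq_trans gt; rewrite ltnS.
move=> t v k j k' j' fl tin vin fl'; rewrite !expand_trace // in tin *.
move=> /(mem_units tr (leqnn T))[e' [lt' c' b']] vin'.
have [e [lt c b]] := mem_units tr (leqnn T) tin.
(* The time intervals of distinct events are disjoint, so both units belong to one event, within
   which the chosen paths are disjoint. *)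
have ee : e = e'.
  case: (ltngtP e e') => // cmp.
    by have := trace_tm_mono tr cmp (ltnW lt'); lia.
  by have := trace_tm_mono tr cmp (ltnW lt); lia.
rewrite -ee in c'; exact (sel_disjoint (trace_sel tr lt) fl fl' c c' vin vin').
Qed.

(** * The completion time bound *)

Definition sent I (pos : nat -> nat) (dn : nat -> nat -> nat) k v :=
  \sum_(q < ncoflows I | pos q <= pos k)
    \sum_(j < nflows I q) (v \in path_nodes I q j) * dn q j.

Lemma sent_leq I (pos : nat -> nat) (dn dn' : nat -> nat -> nat) k v :
    (forall q j, is_flow I q j -> dn q j <= dn' q j) ->
  sent I pos dn k v <= sent I pos dn' k v.
Proof.
move=> le; apply: leq_sum => q _; apply: leq_sum => j _.
by rewrite leq_mul2l le ?orbT // /is_flow !ltn_ord.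
Qed.

Lemma sent_step I (pos : nat -> nat) (dn dn' : nat -> nat -> nat) k v q j d :
    (forall q j, is_flow I q j -> dn q j <= dn' q j) ->
    is_flow I q j -> pos q <= pos k -> v \in path_nodes I q j -> dn q j + d <= dn' q j ->
  sent I pos dn k v + d <= sent I pos dn' k v.
Proof.
move=> le /andP[ltq ltj] lep vin led; rewrite /sent.
rewrite (bigD1 (Ordinal ltq)) //= [leqRHS](bigD1 (Ordinal ltq)) //=.
rewrite (bigD1 (Ordinal ltj)) //= [X in _ <= X + _](bigD1 (Ordinal ltj)) //=.
rewrite vin !mul1n.
have : \sum_(i < nflows I q | i != Ordinal ltj) (v \in path_nodes I q i) * dn q i
    <= \sum_(i < nflows I q | i != Ordinal ltj) (v \in path_nodes I q i) * dn' q i.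
  by apply: leq_sum => i _; rewrite leq_mul2l le ?orbT // /is_flow ltq ltn_ord.
have : \sum_(i < ncoflows I | (pos i <= pos k) && (i != Ordinal ltq))
      \sum_(j < nflows I i) (v \in path_nodes I i j) * dn i j
    <= \sum_(i < ncoflows I | (pos i <= pos k) && (i != Ordinal ltq))
      \sum_(j < nflows I i) (v \in path_nodes I i j) * dn' i j.
  apply: leq_sum => i _; apply: leq_sum => i' _.
  by rewrite leq_mul2l le ?orbT // /is_flow !ltn_ord.
move=> leB leA; rewrite addnAC (addnAC (dn q j)).
exact: leq_add (leq_add led leA) leB.
Qed.

(* While a flow is unfinished, every step after its release is charged: if the
   flow is sent, to all nodes of its path, and otherwise to the node blocking it. *)
Lemma trace_potential I pos T tm dn ch dl e k j : greedy_trace I pos T tm dn ch dl ->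
    is_flow I k j -> e < T -> dn e k j < dem I k j ->
  let pot e := (tm e - rls I k) + (size (path_nodes I k j)).-1 * dn e k j in
  let cap e := \sum_(v <- path_nodes I k j) sent I pos (dn e) k v in
  pot e <= cap e /\ pot e.+1 <= cap e.+1.
Proof.
move=> tr fl lt pd pot cap.
have dn_mono e0 : e0 < T -> forall q i, is_flow I q i -> dn e0 q i <= dn e0.+1 q i.
  by move=> lt0 q i fl'; rewrite (trace_dn tr) // leq_addr.
have step e0 : e0 < T -> dn e0 k j < dem I k j -> pot e0 <= cap e0 -> pot e0.+1 <= cap e0.+1.
  move=> lt0 pd0; have sel := trace_sel tr lt0; have tmE := trace_tm tr lt0.
  have capm : cap e0 <= cap e0.+1.
    by apply: leq_sum => v _; apply/sent_leq/dn_mono.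
  (* Before its release the flow keeps [dl] from passing the release time, so the truncated
     difference stays 0 and [pot] does not grow. *)
  case: (ltnP (tm e0) (rls I k)) => [un|re].
    have /andP[_ le] := sel_wait sel fl isT pd0 un.
    have nc : ch e0 k j = false.
      by apply/negP => /(sel_chosen sel fl)[_]; lia.
    by rewrite /pot (trace_dn tr) // nc tmE; lia.
  have tmE' : tm e0.+1 - rls I k = tm e0 - rls I k + dl e0 by rewrite tmE; lia.
  (* A chosen flow adds [size * dl] to [pot], namely [dl] for the elapsed time and [(size - 1) * dl]
     for the units sent; each of the [size] nodes contributes at least [dl] to [cap]. *)
  case c : (ch e0 k j).
    rewrite /pot (trace_dn tr) // c tmE' mul1n mulnDr => le.
    have nd0 : 0 < size (path_nodes I k j) by [].
    have : cap e0 + size (path_nodes I k j) * dl e0 <= cap e0.+1.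
      rewrite -sum1_size big_distrl -big_split /=.
      apply: (@leq_trans (\sum_(v <- path_nodes I k j | v \in path_nodes I k j)
         (sent I pos (dn e0) k v + 1 * dl e0))); first by rewrite big_seq_cond big_mkcondr.
      rewrite /cap [leqRHS]big_seq; apply: leq_sum => v vin.
      by rewrite mul1n; apply: (sent_step (dn_mono _ lt0) fl) => //; rewrite (trace_dn tr) // c mul1n.
    by move: le nd0; case: (size _) => //= n; rewrite mulSn; lia.
  rewrite /pot (trace_dn tr) // c tmE' mul0n addn0 => le.
  (* A wait is paid for by the shared node alone, through which a coflow not after [k] sends [dl e0]
     units. *)
  have [q [i [v [fl' lep c' v1 v2]]]] := sel_blocked sel fl isT pd0 re (negbT c).
  suff : cap e0 + dl e0 <= cap e0.+1 by lia.
  rewrite /cap (big_rem v) //= [leqRHS](big_rem v) //=.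
  have : sent I pos (dn e0) k v + dl e0 <= sent I pos (dn e0.+1) k v.
    by apply: (sent_step (dn_mono _ lt0) fl') => //; rewrite (trace_dn tr) // c' mul1n.
  have : \sum_(y <- rem v (path_nodes I k j)) sent I pos (dn e0) k y
      <= \sum_(y <- rem v (path_nodes I k j)) sent I pos (dn e0.+1) k y.
    by apply: leq_sum => y _; apply/sent_leq/dn_mono.
  by move=> leS lev; rewrite addnAC; apply: leq_add lev leS.
suff le : pot e <= cap e by split=> //; apply: step.
elim: e lt pd => [|e IH] lt pd.
  by rewrite /pot (trace_tm0 tr) (trace_dn0 tr) // muln0.
have pd' : dn e k j < dem I k j by apply: leq_ltn_trans pd; apply: dn_mono => //; apply: ltnW.
by apply: step => //; [exact: ltnW|apply: IH => //; apply: ltnW].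
Qed.

(** By the end of an event that sends the flow at least one unit is sent, so the potential exceeds
    the elapsed time by at least the length of the path minus 1. On the other side each node of the
    path contributes at most [M k]. *)
Lemma trace_finish I pos T tm dn ch dl (M : nat -> nat) e k j :
    greedy_trace I pos T tm dn ch dl ->
    (forall v, prefix_load I pos k v <= M k) -> is_flow I k j -> e < T -> ch e k j ->
  [/\ rls I k < tm e.+1, 0 < dem I k j
    & tm e.+1 + (size (path_nodes I k j)).-1 <= rls I k + size (path_nodes I k j) * M k].
Proof.
move=> tr leM fl lt c; have sel := trace_sel tr lt.
have [_ re dl0 le] := sel_chosen sel fl c.
have pd : dn e k j < dem I k j by lia.
have tmE := trace_tm tr lt.
split; [by lia|by lia|].
have [_] := trace_potential tr fl lt pd.
rewrite (trace_dn tr) // c mul1n.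
have cap_le : \sum_(v <- path_nodes I k j) sent I pos (dn e.+1) k v
    <= size (path_nodes I k j) * M k.
  rewrite -sum1_size big_distrl /=; apply: leq_sum => v _; rewrite mul1n.
  apply: leq_trans (leM v); apply: leq_sum => q _; apply: leq_sum => i _.
  rewrite leq_mul2l -/(dem I q i) (trace_dn_le tr) ?orbT // /is_flow !ltn_ord //.
have : (size (path_nodes I k j)).-1 <= (size (path_nodes I k j)).-1 * (dn e k j + dl e).
  by rewrite leq_pmulr //; lia.
by move: cap_le; clear -tmE re; lia.
Qed.

Lemma max_path_geq I k j : is_flow I k j -> size (path_nodes I k j) <= max_path I.
Proof.
case/andP=> ltk ltj; rewrite /max_path.
rewrite (big_nth (Coflow 0%R 0 [::])) big_mkord.
apply: leq_trans (leq_bigmax (Ordinal ltk)).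
rewrite (big_nth (Flow 0 0 [::])) big_mkord.
exact: (leq_bigmax (F := fun j : 'I_ _ => size (nodes _)) (Ordinal ltj)).
Qed.

Lemma trace_completion I pos T tm dn ch dl k B : greedy_trace I pos T tm dn ch dl ->
    k < ncoflows I -> (forall j e, is_flow I k j -> e < T -> ch e k j -> tm e.+1 <= B) ->
  completion I (expand (trace_schedule I T tm ch dl)) k <= B.
Proof.
move=> tr ltk le; apply/bigmax_leqP => j _.
have fl : is_flow I k j by rewrite /is_flow ltk ltn_ord.
rewrite expand_trace //; apply/bigmax_leqP_seq => t /(mem_units tr (leqnn T))[e [lt c /andP[_ let_]]] _.
exact: leq_trans let_ (le _ _ fl lt c).
Qed.

(** * The greedy program *)

Definition lower_gap g :=
  put0 vGap g ;;
  SIf (var vDl) (SIf (var vDl [-] var vGap) (put0 vDl (var vGap)) skip)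
    (put0 vDl (var vGap)).

Definition units_left := at2 aDem (var vK) (var vJ) [-] at2 aDone (var vK) (var vJ).

Definition steps_to_release := at1 aRel (var vK) [-] var vTime.

(* A node is busy in event [e] when its mark is [e + 1]; older marks are at most [e]. *)
Definition check_free :=
  put0 vFree (Lit 1) ;;
  SFor vP (at2 aLen (var vK) (var vJ))
    (SIf (at1 aMark current_node [-] var vEv) (put0 vFree (Lit 0)) skip).

(** The 1 stored in [aOut] is provisional: the block length is known only after all flows have been
    considered, and [advance] then puts it in. *)
Definition claim_path :=
  SSet aOut (var vK) (var vJ) (var vEv) (Lit 1) ;;
  SFor vP (at2 aLen (var vK) (var vJ)) (put1 aMark current_node (var vEv [+] Lit 1)).

Definition consider_flow :=
  SIf units_left
    (SIf steps_to_release (lower_gap steps_to_release)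
      (check_free ;; SIf (var vFree) (claim_path ;; lower_gap units_left) skip))
    skip.

Definition select_flows :=
  put0 vDl (Lit 0) ;;
  SFor vS (var vN) (put0 vK (at1 aOrd (var vS)) ;;
    SFor vJ (at1 aNf (var vK)) consider_flow).

Definition advance :=
  put1 aSt (var vEv) (var vTime [+] Lit 1) ;;
  SFor vK (var vN) (SFor vJ (at1 aNf (var vK))
    (SIf (At aOut (var vK) (var vJ) (var vEv))
      (SSet aOut (var vK) (var vJ) (var vEv) (var vDl) ;;
       put2 aDone (var vK) (var vJ) (at2 aDone (var vK) (var vJ) [+] var vDl))
      skip)) ;;
  put0 vTime (var vTime [+] var vDl).

Definition greedy := put0 vTime (Lit 0) ;; SFor vEv (var vT) (select_flows ;; advance).

Lemma lower_gapP N g (s : hstate) : short_factors N s g ->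
  wp N (lower_gap g) s (fun s' => s' vDl 0 0 0 = gap_min (s vDl 0 0 0) (heval s g)).
Proof.
move=> sh; apply/wp_seq/wp_set => //; rewrite /gap_min /minn.
apply: wp_if => /= dl0; last by rewrite dl0; apply: wp_set.
rewrite (gtn_eqF dl0); apply: wp_if => /= cmp; apply: wp_set => //=.
  by case: ltnP => //; lia.
by case: ltnP => //; lia.
Qed.

Lemma check_freeP N I (s : hstate) k j e : fits N I -> instance_read I s -> is_flow I k j ->
    s vK 0 0 0 = k -> s vJ 0 0 0 = j -> s vEv 0 0 0 = e ->
  wp N check_free s (fun s' =>
    (0 < s' vFree 0 0 0) = all (fun v => s aMark v 0 0 <= e) (path_nodes I k j)).
Proof.
move=> fi rd fl ek ej ee; have [_ elen enode] := instance_read_flow rd fl.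
rewrite /path_nodes; move: (nodes _) elen enode (fits_nodes fi fl) => nd elen enode le_nd.
apply/wp_seq/wp_set => //.
apply: (@wp_for _ _ _ _ _ (size nd) (fun p s' =>
  (0 < s' vFree 0 0 0) = all (fun v => s aMark v 0 0 <= e) (take p nd))) => //.
- by rewrite /= ek ej.
- by rewrite take0.
- move=> p s' ltp [fr _ _] IH.
  have enode' : heval (set_at s' vP 0 0 0 p) current_node = nth 0 nd p.
    by rewrite /= !fr //= ek ej enode.
  have em v : s' aMark v 0 0 = s aMark v 0 0 by rewrite fr.
  have ee' : s' vEv 0 0 0 = e by rewrite fr.
  rewrite (take_nth 0) // all_rcons -IH; move: enode' => /= enode'.
  by apply: wp_if => /=; rewrite enode' em ee' => cmp; apply: wp_set => //=;
    move: cmp; rewrite leqNgt; case: ltnP; lia.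
by move=> s' _; rewrite take_size.
Qed.

Lemma claim_pathP N I (s : hstate) k j e : fits N I -> instance_read I s -> is_flow I k j ->
    s vK 0 0 0 = k -> s vJ 0 0 0 = j -> s vEv 0 0 0 = e ->
  wp N claim_path s (fun s' =>
    (forall v, s' aMark v 0 0 = if v \in path_nodes I k j then e.+1 else s aMark v 0 0) /\
    forall k' j' e', s' aOut k' j' e' =
      if [&& k' == k, j' == j & e' == e] then 1 else s aOut k' j' e').
Proof.
move=> fi rd fl ek ej ee; have [_ elen enode] := instance_read_flow rd fl.
rewrite /path_nodes; move: (nodes _) elen enode (fits_nodes fi fl) => nd elen enode le_nd.
apply/wp_seq/wp_set => //.
apply: (@wp_for _ _ _ _ _ (size nd) (fun p s' =>
  forall v, s' aMark v 0 0 = if v \in take p nd then e.+1 else s aMark v 0 0)) => //.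
- by rewrite /= ek ej.
- by rewrite take0.
- move=> p s' ltp [fr _ _] IH; apply: wp_set => //.
  have enode' : s' aNode (s' vK 0 0 0) (s' vJ 0 0 0) p = nth 0 nd p.
    by rewrite !fr //= ek ej enode.
  have ee' : s' vEv 0 0 0 = e by rewrite fr.
  move=> v; rewrite (take_nth 0) // mem_rcons inE /= enode' ee' addn1 IH eqxx !andbT.
  by case: eqP.
move=> s' [fr _ _] IH; split; first by move=> v; rewrite IH take_size.
by move=> k' j' e'; rewrite fr //= ek ej ee.
Qed.

(** [o] is the content of [aOut] before the event. [ss_top] makes every mark count as old in the
    next event, so marks are never cleared. *)
Record sel_state I pos dn t e (o : nat -> nat -> nat -> nat) D (s : hstate) : Prop := SelState {
  ss_sel : selection I pos dn t D (fun k j => 0 < s aOut k j e) (s vDl 0 0 0);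
  ss_mark : forall v, (e < s aMark v 0 0) <->
    exists k j, [/\ is_flow I k j, 0 < s aOut k j e & v \in path_nodes I k j];
  ss_top : forall v, s aMark v 0 0 <= e.+1;
  ss_out : forall k j e', e' != e -> s aOut k j e' = o k j e' }.

Lemma consider_flowP N I (s : hstate) pos dn t e o D k j : fits N I -> instance_read I s ->
    is_flow I k j -> s vK 0 0 0 = k -> s vJ 0 0 0 = j -> s vEv 0 0 0 = e ->
    s vTime 0 0 0 = t -> s aDone k j 0 = dn k j -> D k j = false ->
    (forall k' j', is_flow I k' j' -> D k' j' -> pos k' <= pos k) ->
    sel_state I pos dn t e o D s ->
  wp N consider_flow s (sel_state I pos dn t e o (add_flow D k j)).
Proof.
move=> fi rd fl ek ej ee et ed nD prio [sel mark top out].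
have [edem elen enode] := instance_read_flow rd fl.
have erel : s aRel k 0 0 = rls I k by case: rd (fl) => _ _ r /andP[/r[]].
have left_ : heval s units_left = dem I k j - dn k j by rewrite /= ek ej edem ed.
have wait : heval s steps_to_release = rls I k - t by rewrite /= ek erel et.
have nc : (0 < s aOut k j e) = false.
  by apply/negP => c; have [] := sel_chosen sel fl c; rewrite nD.
apply: wp_if; rewrite left_ => pd; last first.
  apply: wp_set => //; split=> //=; apply: selection_skip => //; left.
  by move/eqP: pd; rewrite subn_eq0.
rewrite subn_gt0 in pd.
apply: wp_if; rewrite wait => un.
  rewrite subn_gt0 in un.
  apply: wp_conseq (lower_gapP _) _ => // s' [fr _ _]; rewrite wait => edl.
  have fo k' j' e' : s' aOut k' j' e' = s aOut k' j' e' by rewrite fr.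
  have fm v : s' aMark v 0 0 = s aMark v 0 0 by rewrite fr.
  split; rewrite ?edl.
  - apply: selection_eq (selection_wait fl pd un sel) => // k' j' _; by rewrite fo.
  - move=> v; rewrite fm mark; by split=> -[k' [j' [fl' c v']]]; exists k', j'; split; rewrite ?fo // -fo.
  - by move=> v; rewrite fm.
  - by move=> k' j' e' ne; rewrite fo out.
have re : rls I k <= t by move/eqP: un; rewrite subn_eq0.
apply/wp_seq/(wp_conseq (check_freeP fi rd fl ek ej ee)) => s1 pr1 free.
have [fr1 _ _] := pr1.
have fo1 k' j' e' : s1 aOut k' j' e' = s aOut k' j' e' by rewrite fr1.
have fm1 v : s1 aMark v 0 0 = s aMark v 0 0 by rewrite fr1.
have fd1 : s1 vDl 0 0 0 = s vDl 0 0 0 by rewrite fr1.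
apply: wp_if; rewrite -[heval s1 (var vFree)]/(s1 vFree 0 0 0) => isfree; last first.
  move: free; rewrite isfree => /esym/negbT/allPn[v vin]; rewrite -ltnNge => /mark[k' [j' [fl' c vin']]].
  have [Dk' _ _ _] := sel_chosen sel fl' c.
  apply: wp_set => //; split=> /=.
  (* The occupant of the busy node was considered earlier, so its coflow comes not after [k] and is
     an admissible blocker. *)
  - rewrite fd1; apply: selection_eq (selection_skip _ sel) => // [k2 j2 _|]; first by rewrite fo1.
    right; split=> //; exists k', j', v; split=> //; exact: prio fl' Dk'.
  - move=> u; rewrite fm1 mark; by split=> -[k2 [j2 [fl2 c2 v2]]]; exists k2, j2; split; rewrite ?fo1 // -fo1.
  - by move=> u; rewrite fm1.
  - by move=> k2 j2 e' ne; rewrite fo1 out.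
have rd1 : instance_read I s1 := instance_read_preserved pr1 rd isT.
have ek1 : s1 vK 0 0 0 = k by rewrite fr1.
have ej1 : s1 vJ 0 0 0 = j by rewrite fr1.
have ee1 : s1 vEv 0 0 0 = e by rewrite fr1.
apply/wp_seq/(wp_conseq (claim_pathP fi rd1 fl ek1 ej1 ee1)) => s2 [fr2 _ _] [mark2 out2].
apply: wp_conseq (lower_gapP _) _ => // s3 [fr3 _ _].
have -> : heval s2 units_left = dem I k j - dn k j.
  by rewrite -left_ /= !fr2 // !fr1.
rewrite fr2 // fd1 => edl.
have fo3 k' j' e' : s3 aOut k' j' e' =
    if [&& k' == k, j' == j & e' == e] then 1 else s aOut k' j' e'.
  by rewrite fr3 // out2 fo1.
have fm3 v : s3 aMark v 0 0 = if v \in path_nodes I k j then e.+1 else s aMark v 0 0.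
  by rewrite fr3 // mark2 fm1.
have chE k' j' : (0 < s3 aOut k' j' e) = add_flow (fun k j => 0 < s aOut k j e) k j k' j'.
  by rewrite fo3 eqxx andbT /add_flow; case: (_ && _); rewrite ?orbT ?orbF.
split.
- rewrite edl; apply: selection_eq (selection_choose fl pd re _ sel) => //.
  move=> k' j' v fl' c vin; apply/negP => vin'.
  have /allP/(_ v vin) : all (fun v => s aMark v 0 0 <= e) (path_nodes I k j) by rewrite -free.
  by rewrite leqNgt => /negP[]; apply/mark; exists k', j'.
- move=> v; rewrite fm3; split.
    case: ifP => vin; first by exists k, j; rewrite chE /add_flow !eqxx orbT.
    move=> /mark[k' [j' [fl' c vin']]]; exists k', j'.
    by rewrite chE /add_flow c.
  case=> k' [j' [fl']]; rewrite chE => /orP[c vin|/andP[/eqP-> /eqP->] ->]; last by [].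
  by case: ifP => // _; apply/mark; exists k', j'.
- by move=> v; rewrite fm3; case: ifP.
by move=> k' j' e' ne; rewrite fo3 (negbTE ne) !andbF out.
Qed.

Lemma sel_state_eq I pos dn t e o (D D' : nat -> nat -> bool) s :
    (forall k j, is_flow I k j -> D k j = D' k j) ->
  sel_state I pos dn t e o D s -> sel_state I pos dn t e o D' s.
Proof. by move=> eD [sel mark top out]; split=> //; apply: selection_eq sel. Qed.

Lemma sel_state_set_at I pos dn t e o D s a x :
    a \notin [:: vDl; aMark; aOut] ->
  sel_state I pos dn t e o D s -> sel_state I pos dn t e o D (set_at s a 0 0 0 x).
Proof.
rewrite !inE !negb_or => /and3P[/negPf n1 /negPf n2 /negPf n3] [sel mark top out].
have same a' i' j' l : a' \in [:: vDl; aMark; aOut] ->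
    set_at s a 0 0 0 x a' i' j' l = s a' i' j' l.
  rewrite !inE /= -[eqn a' a]/(a' == a) => /or3P[] /eqP->;
  by rewrite eq_sym ?n1 ?n2 ?n3.
split.
- rewrite same //; apply: selection_eq sel => // k j _; by rewrite same.
- move=> v; rewrite same // mark; split=> -[k [j]]; rewrite ?same // => h.
    by exists k, j; rewrite same.
  by exists k, j.
- by move=> v; rewrite same.
by move=> k j e' ne; rewrite same // out.
Qed.

Lemma select_flowsP N I (s : hstate) ord pos dn t e o : fits N I -> instance_read I s ->
    good_priority I ord pos -> (forall i, s aOrd i 0 0 = ord i) ->
    s vEv 0 0 0 = e -> s vTime 0 0 0 = t ->
    (forall k j, is_flow I k j -> s aDone k j 0 = dn k j) ->
    (forall k j e', s aOut k j e' = o k j e') -> (forall k j, o k j e = 0) ->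
    (forall v, s aMark v 0 0 <= e) ->
  wp N select_flows s (sel_state I pos dn t e o all_flows).
Proof.
move=> fi rd [ordP posP _] eord ee et ed eo o0 mark0; have [en _ _] := rd.
set n := ncoflows I in ordP posP *.
apply/wp_seq/wp_set => //; set s0 := set_at _ _ _ _ _ _.
apply: (@wp_for _ _ _ _ _ n
  (fun i s' => sel_state I pos dn t e o (fun k _ => pos k < i) s')) => //.
- exact: fits_ncoflows fi.
- split=> /=.
  + split=> //; first by move=> k j _; rewrite eo o0.
      by move=> k j k' j' v _ _; rewrite eo o0.
    by left.
  + move=> v; split; first by rewrite ltnNge mark0.
    by case=> k [j [_]]; rewrite eo o0.
  + by move=> v; rewrite (leq_trans (mark0 v)).
  + by move=> k j e' _.
- move=> i s1 lti pr1 ss; have [fr1 _ _] := pr1.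
  have rd1 : instance_read I s1 by apply: (instance_read_preserved (s := s0)) pr1 rd isT.
  have [ltk posk] := ordP i lti; set k := ord i in ltk posk.
  apply/wp_seq/wp_set => //.
  have eo1 : s1 aOrd i 0 0 = k by rewrite fr1 //= eord.
  set s2 := set_at _ _ _ _ _ _.
  have ek2 : s2 vK 0 0 0 = k by rewrite /s2 /= eo1.
  apply: (@wp_for _ _ _ _ _ (nflows I k)
    (fun j s' => sel_state I pos dn t e o
       (fun k' j' => (pos k' < i) || (k' == k) && (j' < j)) s')) => //.
  + by rewrite -(instance_read_nf rd1 ltk) /= eo1.
  + exact: fits_nflows.
  + do 2! [apply: sel_state_set_at => //]; apply: (sel_state_eq _ ss) => k' j' _.
    by rewrite andbF orbF.
  + move=> j s3 ltj pr3 ss3; have [fr3 _ _] := pr3.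
    have fl : is_flow I k j by rewrite /is_flow ltk ltj.
    have rd3 : instance_read I s3.
      by apply: (instance_read_preserved (s := s2)) pr3 _ isT.
    apply: wp_conseq.
      apply: (@consider_flowP N I _ pos dn t e o
        (fun k' j' => (pos k' < i) || (k' == k) && (j' < j)) k j) => //=.
      * by rewrite fr3.
      * by rewrite fr3 //= fr1.
      * by rewrite fr3 //= fr1.
      * by rewrite fr3 //= fr1 //= ed.
      * by rewrite posk ltnn eqxx ltnn.
      * by move=> k' j' fl'; rewrite posk => /orP[/ltnW //|/andP[/eqP-> _]]; rewrite posk.
      * exact: sel_state_set_at.
    move=> s4 _; apply: sel_state_eq => k' j' _.
    rewrite /add_flow ltnS [j' <= j]leq_eqVlt; case: (_ < i) => //=.
    by case: (k' == k); case: (j' == j); rewrite ?orbT ?orbF.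
  move=> s3 _; apply: sel_state_eq => k' j' fl.
  rewrite ltnS [pos k' <= i]leq_eqVlt; case: (ltnP (pos k') i); rewrite ?orbT //= orbF => ge.
  have /andP[ltk' ltj'] := fl.
  have [_ opk] := posP k' ltk'.
  apply/andP/eqP => [[/eqP-> _]|eq] //.
  have ekk : k' = k by rewrite -opk eq.
  by split; [rewrite ekk|rewrite -ekk].
move=> s1 _; apply: sel_state_eq => k j /andP[ltk _].
by have [-> _] := posP k ltk.
Qed.

Lemma advanceP N I (s : hstate) e : fits N I -> instance_read I s -> s vEv 0 0 0 = e ->
  wp N advance s (fun s' =>
    [/\ s' vTime 0 0 0 = s vTime 0 0 0 + s vDl 0 0 0,
        forall i, s' aSt i 0 0 = if i == e then s vTime 0 0 0 + 1 else s aSt i 0 0,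
        forall k j, is_flow I k j ->
          s' aOut k j e = (0 < s aOut k j e) * s vDl 0 0 0 /\
          s' aDone k j 0 = s aDone k j 0 + (0 < s aOut k j e) * s vDl 0 0 0
      & forall k j e', e' != e -> s' aOut k j e' = s aOut k j e']).
Proof.
move=> fi rd ee; have [en _ _] := rd; set n := ncoflows I in en.
apply/wp_seq/wp_set => //=; rewrite ee; set s0 := set_at _ _ _ _ _ _.
pose dl := s vDl 0 0 0.
pose updated (P : nat -> nat -> bool) (s' : hstate) := forall k j,
  (s' aOut k j e = if P k j then (0 < s aOut k j e) * dl else s aOut k j e) /\
  (s' aDone k j 0 = s aDone k j 0 + P k j * ((0 < s aOut k j e) * dl)) /\
  (forall e', e' != e -> s' aOut k j e' = s aOut k j e').
have updated_eq P P' s' : updated P s' ->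
    (forall k j, P k j = P' k j) -> updated P' s'.
  by move=> u eP k j; rewrite -eP; apply: u.
apply: wp_seq.
apply: (@wp_for _ _ _ _ _ n
  (fun i => updated (fun k j => (k < i) && (j < nflows I k)))) => //.
- exact: fits_ncoflows fi.
- by move=> k j /=; rewrite addn0.
- move=> k s1 ltk pr1 u1; have [fr1 _ _] := pr1.
  have rd1 : instance_read I s1 by apply: (instance_read_preserved (s := s0)) pr1 rd isT.
  apply: (@wp_for _ _ _ _ _ (nflows I k) (fun i => updated (fun k' j =>
    (k' < k) && (j < nflows I k') || (k' == k) && (j < i)))) => //.
  + by rewrite /= (instance_read_nf rd1).
  + exact: fits_nflows.
  + by apply: updated_eq u1 _ => k' j; rewrite andbF orbF.
  + move=> j s2 ltj [fr2 _ _] u2.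
    have [out2 [done2 oth2]] := u2 k j.
    have ek : s2 vK 0 0 0 = k by rewrite fr2.
    have ee2 : s2 vEv 0 0 0 = e by rewrite fr2 //= fr1 //= .
    have edl : s2 vDl 0 0 0 = dl by rewrite fr2 //= fr1 //= .
    rewrite ltnn eqxx ltnn /= in out2 done2.
    rewrite addn0 in done2.
    have ext k' j' : (k' < k) && (j' < nflows I k') || (k' == k) && (j' < j.+1) =
        ((k' < k) && (j' < nflows I k') || (k' == k) && (j' < j)) || (k' == k) && (j' == j).
      by rewrite ltnS [j' <= j]leq_eqVlt; case: (k' == k) => //=; rewrite ?orbF // -orbA [(_ < _) || _]orbC.
    apply: wp_if => /=; rewrite ek ee2 out2 => c.
      apply/wp_seq/wp_set => //=; apply: wp_set => //= k' j'; rewrite ext.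
      rewrite /= !ek !ee2 !edl !eqxx !andbT.
      have [out2' [done2' oth2']] := u2 k' j'.
      case: (boolP ((k' == k) && (j' == j))) => [/andP[/eqP-> /eqP->]|neq].
        rewrite !eqxx orbT /= c mul1n done2 mul1n; split=> //; split=> // e' ne.
        by rewrite (negbTE ne) oth2.
      rewrite !orbF; split=> //; split=> // e' ne.
      by rewrite (negbTE ne) !andbF oth2'.
    apply: wp_set => //= k' j'; rewrite ext /=.
    have [out2' [done2' oth2']] := u2 k' j'.
    case: (boolP ((k' == k) && (j' == j))) => [/andP[/eqP ek' /eqP ej']|neq].
      by rewrite /= ek' ej' orbT out2 c done2 muln0 mul0n addn0.
    by rewrite !orbF.
  move=> s2 _ u2; apply: updated_eq u2 _ => k' j.
  rewrite ltnS [k' <= k]leq_eqVlt; case: (k' =P k) => [->|_] /=; last by rewrite orbF.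
  by rewrite ltnn.
move=> s1 [fr1 _ _] u1; apply: wp_set => //=.
have et : s1 vTime 0 0 0 = s vTime 0 0 0 by rewrite fr1.
have edl : s1 vDl 0 0 0 = dl by rewrite fr1.
split.
- by rewrite et edl.
- by move=> i; rewrite fr1 //= !andbT.
- move=> k j /andP[ltk ltj]; have [-> [-> _]] := u1 k j.
  by rewrite ltk ltj mul1n.
by move=> k j e' ne; have [_ [_ ->]] := u1 k j.
Qed.

Definition greedy_done I pos (s : hstate) := exists tm dn ch dl,
  greedy_trace I pos (s vT 0 0 0) tm dn ch dl /\
  forall e, e < s vT 0 0 0 -> s aSt e 0 0 = tm e + 1 /\
    forall k j, is_flow I k j -> s aOut k j e = ch e k j * dl e.

Lemma greedyP N I (s : hstate) ord pos : fits N I -> instance_read I s ->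
    good_priority I ord pos -> (forall i, s aOrd i 0 0 = ord i) ->
    (forall k j, s aDone k j 0 = 0) -> (forall k j e, s aOut k j e = 0) ->
    (forall v, s aMark v 0 0 = 0) ->
  wp N greedy s (greedy_done I pos).
Proof.
move=> fi rd prio eord done0 out0 mark0; have [_ eT _] := rd.
set T := ncoflows I + _ in eT; apply/wp_seq/wp_set => //; set s0 := set_at _ _ _ _ _ _.
pose R e (s1 s2 : hstate) :=
  [/\ selection I pos (fun k j => s1 aDone k j 0) (s1 vTime 0 0 0) all_flows
        (fun k j => 0 < s2 aOut k j e) (s2 vDl 0 0 0),
      s2 vTime 0 0 0 = s1 vTime 0 0 0 + s2 vDl 0 0 0,
      forall i, s2 aSt i 0 0 = if i == e then s1 vTime 0 0 0 + 1 else s1 aSt i 0 0,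
      forall k j, is_flow I k j ->
        s2 aDone k j 0 = s1 aDone k j 0 + (0 < s2 aOut k j e) * s2 vDl 0 0 0 /\
        s2 aOut k j e = (0 < s2 aOut k j e) * s2 vDl 0 0 0
    & forall k j e', e' != e -> s2 aOut k j e' = s1 aOut k j e'].
apply: (@wp_for_hist _ _ _ _ _ T (fun e s' =>
  (forall v, s' aMark v 0 0 <= e) /\ forall k j e', e <= e' -> s' aOut k j e' = 0) R) => //.
- exact: fits_events.
- by split=> [v|k j e' _] /=; rewrite ?mark0 ?out0.
- move=> e s1 lte pr1 [mark1 out1]; have [fr1 _ _] := pr1.
  have rd1 : instance_read I s1 by apply: (instance_read_preserved (s := s0)) pr1 rd isT.
  apply/wp_seq/(wp_conseq (@select_flowsP N I _ ord pos (fun k j => s1 aDone k j 0)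
     (s1 vTime 0 0 0) e (fun k j e' => s1 aOut k j e') fi _ prio _ _ _ _ _ _ _)) => //.
  + by move=> i /=; rewrite fr1 //= eord.
  + by move=> k j; rewrite out1.
  move=> s2 pr2 [sel2 mark2 top2 out2]; have [fr2 _ _] := pr2.
  have rd2 : instance_read I s2 := instance_read_preserved pr2 rd1 isT.
  have ee2 : s2 vEv 0 0 0 = e by rewrite fr2.
  apply: wp_conseq (advanceP fi rd2 ee2) _ => s3 [fr3 _ _] [tm3 st3 flow3 out3].
  have edl : s3 vDl 0 0 0 = s2 vDl 0 0 0 by rewrite fr3.
  (* Overwriting the provisional 1 by [dl] keeps the chosen flows recognisable, because [dl] is
     positive as soon as a flow is chosen. *)
  have chE k j : is_flow I k j -> (0 < s3 aOut k j e) = (0 < s2 aOut k j e).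
    move=> fl; have [-> _] := flow3 k j fl; case c : (0 < s2 aOut k j e) => //.
    by rewrite mul1n; have [_ _ -> _] := sel_chosen sel2 fl c.
  have t2 : s2 vTime 0 0 0 = s1 vTime 0 0 0 by rewrite fr2.
  split; first split.
  + by move=> v; rewrite fr3.
  + by move=> k j e' lt; rewrite out3 ?out2 ?out1 ?(gtn_eqF lt) // ltnW.
  split.
  + rewrite edl; apply: selection_eq sel2 => // k j fl; by rewrite chE.
  + by rewrite tm3 t2 edl.
  + by move=> i; rewrite st3 t2 fr2.
  + move=> k j fl; rewrite !chE // edl; have [-> ->] := flow3 k j fl.
    by rewrite fr2.
  + by move=> k j e' ne; rewrite out3 // out2.
move=> st st0 stJ stR.
have [prT _] := stJ T (leqnn T); have eTT : st T vT 0 0 0 = T.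
  by have [fr _ _] := prT; rewrite fr.
pose ch e k j := 0 < st e.+1 aOut k j e.
pose dl e := st e.+1 vDl 0 0 0.
exists (fun e => st e vTime 0 0 0), (fun e k j => st e aDone k j 0), ch, dl.
rewrite eTT; split.
  split.
  - by rewrite st0.
  - by move=> k j _; rewrite st0 /= done0.
  - by move=> e lt; case: (stR e lt).
  - by move=> e lt; case: (stR e lt).
  - by move=> e k j lt fl; case: (stR e lt) => _ _ _ /(_ k j fl)[].
(* Each event writes only its own entries of [aSt] and [aOut], so those of event [e] persist to the
   end. *)
move=> e lt; have keep m : e < m -> m <= T ->
    st m aSt e 0 0 = st e vTime 0 0 0 + 1 /\
    forall k j, is_flow I k j -> st m aOut k j e = ch e k j * dl e.
  elim: m => // m IH; rewrite ltnS leq_eqVlt => /orP[/eqP<- lt'|lt' ltm].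
    case: (stR e lt') => _ _ -> fl _; rewrite eqxx; split=> // k j /fl[_ ->].
    by rewrite /ch /dl; case: (0 < _); rewrite ?mul1n ?mul0n.
  have [IH1 IH2] := IH lt' (ltnW ltm).
  case: (stR m ltm) => _ _ -> _ outm; rewrite (ltn_eqF lt') IH1; split=> // k j fl.
  by rewrite outm ?IH2 // (ltn_eqF lt').
exact: keep.
Qed.

(** * The complete algorithm *)

Definition write_schedule :=
  SPut (var vN) ;;
  SFor vK (var vN) (SPut (at1 aNf (var vK)) ;;
    SFor vJ (at1 aNf (var vK)) (SPut (var vT) ;;
      SFor vI (var vT) (SPut (at1 aSt (var vI)) ;; SPut (At aOut (var vK) (var vJ) (var vI))))).

Definition solve :=
  read_instance ;; set_weights ;; set_loads ;; order_jobs ;; greedy ;; write_schedule.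

Lemma wp_put_seq (T : Type) (enc : T -> seq nat) (f : nat -> T) N x e p (s : hstate) n :
    heval s e = n -> n <= N ->
    (forall i s', i < n -> preserved (SFor x e p) s s' ->
       wp N p (set_at s' x 0 0 0 i) (fun s'' => outp s'' = outp s' ++ enc (f i))) ->
  wp N (SFor x e p) s (fun s' => outp s' = outp s ++ flatten [seq enc y | y <- mkseq f n]).
Proof.
move=> en nN body; apply: (@wp_for _ _ _ _ _ n (fun i s' =>
  outp s' = outp s ++ flatten [seq enc y | y <- mkseq f i])) => //.
  by rewrite cats0.
move=> i s' lti pr IH; apply: wp_conseq (body i s' lti pr) _ => s'' _ ->.
by rewrite IH /mkseq -[i.+1]addn1 iotaD !map_cat flatten_cat /= cats0 catA.
Qed.

Lemma write_scheduleP N I (s : hstate) tm (ch : nat -> nat -> nat -> bool) dl : fits N I -> instance_read I s ->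
    (forall e, e < s vT 0 0 0 -> s aSt e 0 0 = tm e + 1 /\
       forall k j, is_flow I k j -> s aOut k j e = ch e k j * dl e) ->
  wp N write_schedule s (fun s' =>
    outp s' = outp s ++ encode_schedule (trace_schedule I (s vT 0 0 0) tm ch dl)).
Proof.
move=> fi rd blk; have [en eT _] := rd.
set T := s vT 0 0 0 in eT blk *.
have TN : T <= N by rewrite eT; apply: fits_events.
apply/wp_seq/wp_put; apply: wp_conseq.
  apply: (@wp_put_seq _ (encode_seq (encode_seq encode_pair)) (fun k => mkseq (fun j =>
    mkseq (fun e => (tm e + 1, ch e k j * dl e)) T) (nflows I k)) _ _ _ _ _ (ncoflows I)).
  - by [].
  - exact: fits_ncoflows fi.
  move=> k s1 ltk pr1; have [fr1 _ _] := pr1.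
  have rd1 := instance_read_preserved pr1 rd isT.
  have enf := instance_read_nf rd1 ltk.
  apply/wp_seq/wp_put => /=; apply: wp_conseq.
    apply: (@wp_put_seq _ (encode_seq encode_pair) (fun j =>
      mkseq (fun e => (tm e + 1, ch e k j * dl e)) T) _ _ _ _ _ (nflows I k)).
    + exact: enf.
    + exact: fits_nflows.
    move=> j s2 ltj [fr2 _ _]; have fl : is_flow I k j by rewrite /is_flow ltk ltj.
    have eT2 : s2 vT 0 0 0 = T by rewrite fr2 //= fr1.
    apply/wp_seq/wp_put => /=; apply: wp_conseq.
      apply: (@wp_put_seq _ encode_pair (fun e => (tm e + 1, ch e k j * dl e)) _ _ _ _ _ T) => //.
      move=> e s3 lte [fr3 _ _]; have [st3 out3] := blk e lte.
      apply/wp_seq/wp_put/wp_put => /=.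
      have -> : s3 aSt e 0 0 = tm e + 1 by rewrite fr3 //= fr2 //= fr1.
      rewrite !(fr3 vK) ?(fr3 vJ) //= (fr2 vK) //= (fr3 aOut) //= (fr2 aOut) //= (fr1 aOut) //= out3 //.
      by rewrite -!cats1 -catA.
    by move=> s3 _ ->; rewrite /= eT2 -cats1 -catA /encode_seq size_mkseq.
  by move=> s2 _ ->; rewrite /= enf -cats1 -catA /encode_seq size_mkseq.
by move=> s1 _ ->; rewrite /= en -cats1 -catA /encode_schedule /trace_schedule /encode_seq size_mkseq.
Qed.

Definition solved I (o : seq nat) := exists ord pos T tm dn ch dl,
  [/\ good_priority I ord pos, greedy_trace I pos T tm dn ch dl,
      T = ncoflows I + \sum_(k < ncoflows I) nflows I k
    & o = encode_schedule (trace_schedule I T tm ch dl)].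

Lemma solveP N I : fits N I ->
  wp N solve (HState (fun _ _ _ _ => 0) (encode_instance I) [::])
    (fun s' => solved I (outp s')).
Proof.
move=> fi; set s0 := HState _ _ _.
apply/wp_seq/(wp_conseq (@read_instanceP N s0 I [::] _ _ _ _ _)) => //.
- by rewrite cats0.
- exact: fits_edges fi.
- exact: fits_ncoflows fi.
- exact: fits_nflows.
- move=> k j fl; apply: leq_trans (fits_nodes fi fl); by rewrite /= size_map.
move=> s1 [fr1 _ o1] rd1.
apply/wp_seq/(wp_conseq (set_weightsP fi rd1)) => s2 pr2 wt2; have [fr2 _ o2] := pr2.
have rd2 := instance_read_preserved pr2 rd1 isT.
apply/wp_seq/(wp_conseq (set_loadsP fi rd2 _)) => [v k|s3 pr3 ld3]; first by rewrite fr2 // fr1.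
have [fr3 _ o3] := pr3; have rd3 := instance_read_preserved pr3 rd2 isT.
apply/wp_seq/(wp_conseq (order_jobsP fi rd3 ld3 _)) => [k ltk|s4 pr4 prio].
  by rewrite !fr3 //; apply: wt2.
have [fr4 _ o4] := pr4; have rd4 := instance_read_preserved pr4 rd3 isT.
apply/wp_seq/(wp_conseq (greedyP fi rd4 prio _ _ _ _)) => //.
- by move=> k j; rewrite fr4 // fr3 // fr2 // fr1.
- by move=> k j e; rewrite fr4 // fr3 // fr2 // fr1.
- by move=> v; rewrite fr4 // fr3 // fr2 // fr1.
move=> s5 pr5 [tm [dn [ch [dl [tr blk]]]]].
have [fr5 _ o5] := pr5; have rd5 := instance_read_preserved pr5 rd4 isT.
apply: wp_conseq (write_scheduleP fi rd5 blk) _ => s6 _ o6.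
have [_ eT _] := rd5.
do 7! eexists; split; [exact: prio|exact: tr|exact: eT|].
rewrite o6; move: o5 o4 o3 o2 o1 => /= /eqP-> /eqP-> /eqP-> /eqP-> /eqP->.
by [].
Qed.

(** * Bounds by the input size *)

Definition bits (s : seq nat) := \sum_(x <- s) bitlen x.

Lemma bits_cons x s : bits (x :: s) = bitlen x + bits s.
Proof. by rewrite /bits big_cons. Qed.

Lemma bits_cat s s' : bits (s ++ s') = bits s + bits s'.
Proof. by rewrite /bits big_cat. Qed.

Lemma bits_encode_seq (T : Type) (enc : T -> seq nat) s :
  bits (encode_seq enc s) = bitlen (size s) + \sum_(x <- s) bits (enc x).
Proof.
rewrite bits_cons; congr (_ + _); elim: s => [|x s IH].
  by rewrite /bits !big_nil.
by rewrite /= bits_cat IH big_cons.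
Qed.

Lemma leq_sum_nth (T : Type) (x0 : T) (F : T -> nat) s i :
  i < size s -> F (nth x0 s i) <= \sum_(x <- s) F x.
Proof.
move=> lt; rewrite (big_nth x0) big_mkord (bigD1 (Ordinal lt)) //=.
exact: leq_addr.
Qed.

Lemma bits_flow f :
  bitlen (demand f) + size (nodes f) <= bits (encode_flow f) /\ 0 < bits (encode_flow f).
Proof.
rewrite /encode_flow 2!bits_cons bits_encode_seq /= size_map.
have : size (steps f) <= \sum_(x <- steps f) bits (encode_pair x).
  rewrite -sum1_size; apply: leq_sum => x _.
  by rewrite /encode_pair bits_cons addn_gt0 bitlen_gt0.
have := bitlen_gt0 (source f); have := bitlen_gt0 (demand f); by lia.
Qed.

(** The extra 1, paid for by the release time, accounts for the coflow itself in [fits_events] and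
    for the additive 1 of [bitlen_sum] in the bound on loads. *)
Lemma bits_coflow K :
  [/\ bitlen (absz (numq (weight K))) <= bits (encode_coflow K),
      bitlen (absz (denq (weight K))) <= bits (encode_coflow K)
    & 1 + size (flows K) <= bits (encode_coflow K)] /\
  1 + \sum_(f <- flows K) bits (encode_flow f) <= bits (encode_coflow K).
Proof.
rewrite /encode_coflow 3!bits_cons bits_encode_seq.
have : size (flows K) <= \sum_(f <- flows K) bits (encode_flow f).
  by rewrite -sum1_size; apply: leq_sum => f _; have [] := bits_flow f.
have := bitlen_gt0 (release K).
by do ![split]; lia.
Qed.

Lemma bits_instance I : size (edges I) + \sum_(K <- coflows I) bits (encode_coflow K) < input_size I.
Proof.
rewrite /input_size -/(bits _) /encode_instance bits_cons bits_cat !bits_encode_seq.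
have : size (edges I) <= \sum_(x <- edges I) bits (encode_pair x).
  rewrite -sum1_size; apply: leq_sum => x _.
  by rewrite /encode_pair bits_cons addn_gt0 bitlen_gt0.
have := bitlen_gt0 (nnodes I).
by lia.
Qed.

Lemma bitlen_sum n (a : 'I_n -> nat) : bitlen (\sum_(i < n) a i) <= 1 + \sum_(i < n) bitlen (a i).
Proof.
elim: n a => [|n IH] a; first by rewrite !big_ord0.
rewrite !big_ord_recr /= addnA; apply: leq_trans (bitlenD _ _) _.
by rewrite leq_add2r.
Qed.

Lemma fits_input_size I : valid_instance I -> fits (input_size I) I.
Proof.
case/andP=> _ /(all_nthP (Coflow 0%R 0 [::])) val.
have := bits_instance I.
have coflow_le k : k < ncoflows I ->
    bits (encode_coflow (coflow_at I k)) <= \sum_(K <- coflows I) bits (encode_coflow K).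
  exact: (leq_sum_nth _ (fun K => bits (encode_coflow K))).
have flow_le k j : is_flow I k j -> bits (encode_flow (flow_at I k j))
    <= \sum_(f <- flows (coflow_at I k)) bits (encode_flow f).
  by case/andP=> _; apply: (leq_sum_nth _ (fun f => bits (encode_flow f))).
set N := input_size I => le_N.
split.
- by lia.
- by lia.
- have : ncoflows I + \sum_(k < ncoflows I) nflows I k
      <= \sum_(K <- coflows I) bits (encode_coflow K).
    rewrite [leqRHS](big_nth (Coflow 0%R 0 [::])) big_mkord -[X in X + _]card_ord -sum1_card.
    rewrite -big_split /=; apply: leq_sum => k _.
    by have [[_ _ le] _] := bits_coflow (coflow_at I k).
  by lia.
- by move=> k /coflow_le; have [[_ _]] := bits_coflow (coflow_at I k); rewrite /nflows; lia.
- by move=> k /coflow_le; have [[le _ _] _] := bits_coflow (coflow_at I k); rewrite /num; lia.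
- by move=> k /coflow_le; have [[_ le _] _] := bits_coflow (coflow_at I k); rewrite /den; lia.
- move=> k j fl; have /andP[/coflow_le le1 _] := fl; have := flow_le _ _ fl.
  have [le2 _] := bits_flow (flow_at I k j); have [_] := bits_coflow (coflow_at I k).
  by lia.
- move=> v k; case: (ltnP k (ncoflows I)) => [ltk|ge]; last first.
    rewrite /load /nflows /coflow_at nth_default // big_ord0.
    by apply: leq_trans le_N; rewrite ltnS.
  apply: leq_trans (bitlen_sum _) _.
  have : \sum_(j < nflows I k) bitlen ((v \in nodes (flow_at I k j)) * demand (flow_at I k j))
      <= \sum_(f <- flows (coflow_at I k)) bits (encode_flow f).
    rewrite [leqRHS](big_nth (Flow 0 0 [::])) big_mkord; apply: leq_sum => j _.
    have [le _] := bits_flow (flow_at I k j).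
    apply: leq_trans (leq_trans (leq_addr _ _) le).
    by apply: leq_bitlen; case: (_ \in _); rewrite ?mul1n.
  have := coflow_le k ltk; have [_] := bits_coflow (coflow_at I k).
  by lia.
move=> k j /andP[ltk ltj].
by have /andP[_ /(all_nthP (Flow 0 0 [::]))/(_ j ltj)/and3P[]] := val k ltk.
Qed.

Lemma short_tape_input I : all (fun x => bitlen x <= input_size I) (encode_instance I).
Proof.
apply/allP => x xin; rewrite /input_size (big_rem x) //=; exact: leq_addr.
Qed.

(** * Comparison with an optimal schedule *)

Import Order.TTheory Num.Theory.

Lemma completion_geq I S k j t : is_flow I k j -> t \in S k j -> t <= completion I S k.
Proof.
case/andP=> _ ltj tin; apply: leq_trans (leq_bigmax (Ordinal ltj)) => /=.
exact: leq_bigmax_seq tin isT.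
Qed.

Lemma sum_pair_leq1 n (m : nat -> nat) (A : pred 'I_n) (b : nat -> nat -> bool) :
    (forall k j k' j', k < n -> j < m k -> k' < n -> j' < m k' -> b k j -> b k' j' ->
       (k, j) = (k', j')) ->
  \sum_(k < n | A k) \sum_(j < m k) b k j <= 1.
Proof.
move=> uni.
case: (boolP [exists k : 'I_n, exists j : 'I_(m k), b k j]) => [/existsP[k0 /existsP[j0 b0]]|none].
  apply: (@leq_trans (\sum_(k < n) \sum_(j < m k) b k j)).
    by rewrite [leqLHS]big_mkcond /=; apply: leq_sum => k _; case: (A k).
  rewrite (bigD1 k0) //= (bigD1 j0) //= b0 !big1 //.
    move=> k neq; rewrite big1 // => j _; case bk : (b k j) => //.
    have [] := uni k j k0 j0 (ltn_ord _) (ltn_ord _) (ltn_ord _) (ltn_ord _) bk b0.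
    by move=> /val_inj ek; rewrite ek eqxx in neq.
  move=> j neq; case bk : (b k0 j) => //.
  have [] := uni k0 j k0 j0 (ltn_ord _) (ltn_ord _) (ltn_ord _) (ltn_ord _) bk b0.
  by move=> /val_inj ej; rewrite ej eqxx in neq.
rewrite big1 // => k _; rewrite big1 // => j _; case bk : (b k j) => //.
by case/negP: none; apply/existsP; exists k; apply/existsP; exists j.
Qed.

(** Double counting of the pairs of a time step up to [c] and a flow of [A] through [v] sent in it:
    a flow contributes its demand, a step at most one pair. *)
Lemma feasible_capacity I S : feasible I S ->
  capacity (ncoflows I) (load I) (completion I S).
Proof.
move=> [fl_ok disj] v A c leC.
pose b t k j := (v \in nodes (flow_at I k j)) && (t \in S k j).
apply: (@leq_trans (\sum_(t <- iota 1 c) \sum_(q < ncoflows I | A q)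
    \sum_(j < nflows I q) b t q j)).
  rewrite exchange_big /=; apply: leq_sum => q Aq.
  rewrite exchange_big /=; apply: leq_sum => j _.
  have fl : is_flow I q j by rewrite /is_flow !ltn_ord.
  have [un <- start] := fl_ok _ _ fl.
  rewrite /b; case: (_ \in nodes _) => //=; rewrite mul1n.
  have : {subset S q j <= filter (mem (S q j)) (iota 1 c)}.
    move=> t tin; rewrite mem_filter mem_iota inE tin /= add1n ltnS.
    apply/andP; split; first by have := start t tin; lia.
    exact: leq_trans (completion_geq fl tin) (leC q Aq).
  move/(uniq_leq_size un); rewrite size_filter -sum1_count big_mkcond => /leq_trans; apply.
  by apply: leq_sum => t _; rewrite inE; case: (t \in _).
rewrite -[leqRHS](size_iota 1) -sum1_size; apply: leq_sum => t _.
apply: sum_pair_leq1 => k j k' j' ltk ltj ltk' ltj' /andP[vin tin] /andP[vin' tin'].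
by apply: (disj t v) => //; apply/andP.
Qed.

Definition int_objective I S := \sum_(k < ncoflows I) int_weight I k * completion I S k.

Definition common_den I : nat := \prod_(k < ncoflows I) den I k.

Lemma den_gt0 I k : 0 < den I k.
Proof. by rewrite /den absz_gt0 denq_neq0. Qed.

Lemma common_den_gt0 I : 0 < common_den I.
Proof. by rewrite /common_den prodn_gt0 // => k; apply: den_gt0. Qed.

Lemma weight_ge0 I k : valid_instance I -> (0 <= weight (coflow_at I k))%R.
Proof.
case/andP=> _ /(all_nthP (Coflow 0%R 0 [::])) val.
case: (ltnP k (size (coflows I))) => [/val/andP[] //|ge].
by rewrite /coflow_at nth_default.
Qed.

Lemma int_weightE I k : valid_instance I -> k < ncoflows I ->
  ((int_weight I k)%:R = weight (coflow_at I k) * (common_den I)%:R :> rat)%R.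
Proof.
move=> val ltk; rewrite /int_weight /common_den (bigD1 (Ordinal ltk)) //= eqxx.
rewrite [in RHS](bigD1 (Ordinal ltk)) //=.
rewrite (eq_bigr (fun i : 'I_(ncoflows I) => den I i)) => [|i neq]; last first.
  by case: eqP => // eq; case/eqP: neq; apply: val_inj.
rewrite !natrM mulrA; congr (_ * _)%R.
have ge0 := weight_ge0 k val.
have -> : ((num I k)%:R = (numq (weight (coflow_at I k)))%:~R :> rat)%R.
  by rewrite /num natr_absz ger0_norm ?numq_ge0.
have -> : ((den I k)%:R = (denq (weight (coflow_at I k)))%:~R :> rat)%R.
  by rewrite /den natr_absz gtr0_norm ?denq_gt0.
by rewrite numqE.
Qed.

Lemma objectiveE I S : valid_instance I ->
  (objective I S * (common_den I)%:R = (int_objective I S)%:R)%R.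
Proof.
move=> val; rewrite /objective /int_objective natr_sum big_distrl /=.
by apply: eq_bigr => k _; rewrite natrM int_weightE // mulrAC.
Qed.

(** Objective values are natural numbers over the common denominator, so the descent to better
    schedules terminates. Excluded middle decides at each stage whether a better one exists. *)
Lemma optimal_exists I S : valid_instance I -> feasible I S -> exists S', optimal I S'.
Proof.
move=> val; move: {2}(int_objective I S) (leqnn (int_objective I S)) => m.
elim: m S => [|m IH] S le fS.
  exists S; split=> // S' _; rewrite -(ler_pM2r (x := (common_den I)%:R%R)) ?ltr0n ?common_den_gt0 //.
  by rewrite !objectiveE // ler_nat (leq_trans le).
case: (classic (exists S', feasible I S' /\ int_objective I S' <= m)) => [[S' [fS' le']]|none].
  exact: IH le' fS'.
exists S; split=> // S' fS'; rewrite -(ler_pM2r (x := (common_den I)%:R%R)) ?ltr0n ?common_den_gt0 //.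
rewrite !objectiveE // ler_nat (leq_trans le) // ltnNge; apply/negP => le'.
by apply: none; exists S'.
Qed.

(** Treats both ratios: [a = 1] when release times are charged to [S'], and [a = 0] when they are
    absorbed. Multiplication by the common denominator and by [n + 1] reduces the claim to natural
    numbers. *)
Lemma approximation_bound I S S' (M : nat -> nat) a : valid_instance I ->
    (forall k, k < ncoflows I -> completion I S k <= a * completion I S' k + max_path I * M k) ->
    (ncoflows I).+1 * \sum_(k < ncoflows I) int_weight I k * M k
      <= 2 * ncoflows I * int_objective I S' ->
  (objective I S <= (2 * (ncoflows I)%:R / ((ncoflows I)%:R + 1) * (max_path I)%:R + a%:R)
    * objective I S')%R.
Proof.
move=> val leC leM; set n := ncoflows I in leC leM *; set l := max_path I in leC *.
have D0 : (0 < (common_den I)%:R :> rat)%R by rewrite ltr0n common_den_gt0.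
have n0 : (0 < n%:R + 1 :> rat)%R by rewrite ltr_wpDl.
have alphaE : ((n%:R + 1) * (2 * n%:R / (n%:R + 1) * l%:R + a%:R)
    = (2 * n * l + n.+1 * a)%:R :> rat)%R.
  by rewrite natrD !natrM -[n.+1]addn1 natrD; field; rewrite lt0r_neq0.
rewrite -(ler_pM2r D0) -(ler_pM2l n0) objectiveE // -(mulrA _ (objective I S')).
rewrite objectiveE // mulrA alphaE -[(n%:R + 1)%R]/(n%:R + 1%:R)%R -natrD -!natrM ler_nat addn1.
have : int_objective I S <= a * int_objective I S' + l * \sum_(k < n) int_weight I k * M k.
  rewrite /int_objective !big_distrr -big_split /=; apply: leq_sum => k _.
  rewrite [a * _]mulnCA [l * _]mulnCA -mulnDr leq_mul2l; apply/orP; right.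
  exact: leC.
move=> leO; apply: leq_trans (leq_mul (leqnn n.+1) leO) _.
rewrite mulnDr mulnDl addnC; apply: leq_add; last by rewrite mulnA.
rewrite [n.+1 * _]mulnCA; apply: leq_trans (leq_mul (leqnn l) leM) _.
by rewrite mulnA (mulnC l).
Qed.

(** A flow that is sent has positive demand, so [S'] must send it too, after the release of [k];
    hence [rls I k <= completion I S' k]. *)
Lemma trace_completion_any I pos T tm dn ch dl (M : nat -> nat) S' k :
    greedy_trace I pos T tm dn ch dl -> feasible I S' -> k < ncoflows I ->
    (forall v, prefix_load I pos k v <= M k) ->
  completion I (expand (trace_schedule I T tm ch dl)) k
    <= 1 * completion I S' k + max_path I * M k.
Proof.
move=> tr [fl_ok _] ltk leM; apply: (trace_completion tr ltk) => j e fl lte c.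
have [_ dem0 le] := trace_finish tr leM fl lte c.
have [un sz start] := fl_ok k j fl.
have : rls I k <= completion I S' k.
  case eS : (S' k j) (sz) => [|t s]; first by rewrite /= => z; rewrite /dem -z in dem0.
  move=> _; have tin : t \in S' k j by rewrite eS mem_head.
  by apply: leq_trans (completion_geq fl tin); have := start t tin; rewrite /rls; lia.
have : size (path_nodes I k j) * M k <= max_path I * M k by rewrite leq_mul2r max_path_geq ?orbT.
by lia.
Qed.

(** For a path of [p] nodes, [r_k <= l - 1] and [M >= 1] give [r_k + p * M - (p - 1) <= l + p * (M -
    1) <= l * M]. *)
Lemma trace_completion_small I pos T tm dn ch dl (M : nat -> nat) S' k :
    greedy_trace I pos T tm dn ch dl -> small_release I -> k < ncoflows I ->
    (forall v, prefix_load I pos k v <= M k) ->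
  completion I (expand (trace_schedule I T tm ch dl)) k
    <= 0 * completion I S' k + max_path I * M k.
Proof.
move=> tr sm ltk leM; apply: (trace_completion tr ltk) => j e fl lte c.
have [rel_lt dem0 le] := trace_finish tr leM fl lte c.
have := sm k ltk; rewrite -/(rls I k); have := max_path_geq fl.
have : 0 < size (path_nodes I k j) by [].
move: le; set p := size _; set l := max_path I => le p0 pl rl.
have M0 : 0 < M k by case: (M k) le => // le; lia.
by rewrite mul0n add0n; nia.
Qed.

Lemma solve_approximates (X : instance -> Prop) a :
    (forall I pos T tm dn ch dl (M : nat -> nat) S' k, X I ->
       greedy_trace I pos T tm dn ch dl -> feasible I S' -> k < ncoflows I ->
       (forall v, prefix_load I pos k v <= M k) ->
       completion I (expand (trace_schedule I T tm ch dl)) k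
         <= a * completion I S' k + max_path I * M k) ->
  approximation_algorithm X (fun I =>
    (2 * (ncoflows I)%:R / ((ncoflows I)%:R + 1) * (max_path I)%:R + a%:R)%R)
    (compile 0 solve).
Proof.
move=> bound; exists (time 0 solve * ('X + 'X * growth solve))%R => I val XI.
have fi := fits_input_size val.
have [safe_ [ord [pos [T [tm [dn [ch [dl [prio tr eT eo]]]]]]]]] := solveP fi.
have [c [halt le]] := compile_halts (fits_pos fi) (short_tape_input I) safe_.
have fS := trace_feasible tr (fun k j fl => trace_done tr eT fl).
exists c, (trace_schedule I T tm ch dl); split=> //; first by rewrite -eo.
have [S' opt] := optimal_exists val fS; exists S'; split=> //.
have [fS' _] := opt; have [_ _ [M [leM bnd]]] := prio.
apply: (@approximation_bound _ _ _ M) => //; last exact: bnd (feasible_capacity fS').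
by move=> k ltk; apply: (bound _ pos _ _ dn) => // v; apply: leM.
Qed.

Theorem theorem5 :
  (exists A : program,
     approximation_algorithm any_release
       (fun I : instance =>
          (2 * (ncoflows I)%:R / ((ncoflows I)%:R + 1) * (max_path I)%:R + 1)%R)
       A) /\
  (exists A : program,
     approximation_algorithm small_release
       (fun I : instance =>
          (2 * (ncoflows I)%:R / ((ncoflows I)%:R + 1) * (max_path I)%:R)%R)
       A).
Proof.
(* One program serves both claims; only the completion bound, with [a = 1] or [a = 0], differs. *)
split; exists (compile 0 solve).
  apply: (@solve_approximates any_release 1) => I pos T tm dn ch dl M S' k _.
  exact: trace_completion_any.
have [p sol] := @solve_approximates small_release 0
  (fun I pos T tm dn ch dl M S' k sm tr _ => trace_completion_small S' tr sm).
exists p => I val sm; have [c [C [h1 h2 h3 [S' [opt le]]]]] := sol I val sm.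
by exists c, C; split=> //; exists S'; rewrite addr0 in le.
Qed.
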